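(* Let $u\in H^1(\mathbb{S}^1,\mathbb{R})$. Then for any vector field $X$ on $\mathbb{S}^1$ whose flow is a family of traces of automorphisms of $D^2$ there holds $$u\,\frac{d}{dx}\left[(-\Delta)^{\frac12}u\,X\right]=u\,(-\Delta)^{\frac12}\left(u'X\right)$$ in the sense of distributions. In particular $$\int_{\mathbb{S}^1}u'(x)(-\Delta)^{\frac12}u(x)\,dx=0,$$ and for any $\delta\in\mathbb{S}^1$ $$\int_{\mathbb{S}^1}u'(x)(-\Delta)^{\frac12}u(x)\sin(x-\delta)\,dx=0.$$
   Context: $\mathbb{S}^1=\mathbb{R}/2\pi\mathbb{Z}$ is identified with $\partial D^2$ ($D^2$ the unit disc of $\mathbb{C}$) via $x\mapsto e^{ix}$; vector fields on $\mathbb{S}^1$ are identified with real functions. Automorphisms of $D^2$ are biholomorphic maps $D^2\to D^2$, i.e. $z\mapsto\mu\frac{z-a}{\bar az-1}$ with $|\mu|=1$, $|a|<1$; they extend to diffeomorphisms of $\overline{D^2}$ and their trace is the restriction to $\partial D^2$. $(-\Delta)^{\frac12}$ is the Fourier multiplier $|k|$ on $\mathscr{D}'(\mathbb{S}^1)$. The products with $u\in H^1(\mathbb{S}^1)$ are the distributions $\varphi\mapsto-\int_{\mathbb{S}^1}(-\Delta)^{\frac12}u\,X\,(u\varphi)'\,dx$ and $\varphi\mapsto\int_{\mathbb{S}^1}u'X\,(-\Delta)^{\frac12}(u\varphi)\,dx$ for $\varphi\in C^\infty(\mathbb{S}^1)$, respectively. *)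

(* Defs.v *)
From HB Require Import structures.
From mathcomp Require Import all_boot all_order all_algebra.
From mathcomp Require Import all_classical all_reals all_analysis.
From mathcomp Require Import complex.

Set Implicit Arguments.
Unset Strict Implicit.
Unset Printing Implicit Defensive.

Import Order.TTheory GRing.Theory Num.Theory.
Import numFieldNormedType.Exports.

Local Open Scope classical_set_scope.
Local Open Scope ring_scope.

(* Functions on the circle R / 2 pi Z are 2 pi-periodic functions on R,
   integrated over one period. *)
Definition on_circle (R : realType) (f : R -> R) : Prop := periodic f (pi *+ 2).

Definition circle_int (R : realType) (f : R -> R) : R :=
  \int[lebesgue_measure]_(x in `[0%R, pi *+ 2]) f x.

Definition smooth_circle (R : realType) (phi : R -> R) : Prop :=
  on_circle phi /\ forall (n : nat) (x : R), derivable (derive1n n phi) x 1.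

Definition L2_circle (R : realType) (f : R -> R) : Prop :=
  [/\ on_circle f, measurable_fun setT f &
      (@lebesgue_measure R).-integrable `[0%R, pi *+ 2]
        (fun x => (f x ^+ 2)%:E)].

Definition is_weak_derivative (R : realType) (u v : R -> R) : Prop :=
  forall phi : R -> R, smooth_circle phi ->
    circle_int (fun x => u x * derive1 phi x) = - circle_int (fun x => v x * phi x).

Definition H1_circle (R : realType) (u : R -> R) : Prop :=
  L2_circle u /\ exists v : R -> R, L2_circle v /\ is_weak_derivative u v.

(* The derivative u' of u in H^1, as an L^2 function. It is unique up to a null
   set; xget picks a representative (and returns 0 if there is none). *)
Definition weak_derivative (R : realType) (u : R -> R) : R -> R :=
  xget (cst 0) [set v | L2_circle v /\ is_weak_derivative u v].

(* (2 pi)^-1 int f(x) e^(-ikx) dx *)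
Definition fourier_coef (R : realType) (f : R -> R) (k : int) : R[i] :=
  ((circle_int (fun x => f x * cos (k%:~R * x)) / (pi *+ 2))%R -i*
   (circle_int (fun x => f x * sin (k%:~R * x)) / (pi *+ 2))%R)%C.

(* The distribution defined by v is the image of the distribution defined by u
   under the Fourier multiplier |k|: a distribution on the circle is determined
   by its Fourier coefficients. *)
Definition is_half_laplacian (R : realType) (u v : R -> R) : Prop :=
  forall k : int, fourier_coef v k = `|k|%:~R * fourier_coef u k.

(* (-Delta)^(1/2) u as an L^2 function, which exists for every u in H^1 and is
   unique up to a null set; same convention as for weak_derivative. *)
Definition half_laplacian (R : realType) (u : R -> R) : R -> R :=
  xget (cst 0) [set v | L2_circle v /\ is_half_laplacian u v].

Definition expi (R : realType) (x : R) : R[i] := (cos x +i* sin x)%C.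

Definition disc_automorphism (R : realType) (mu a z : R[i]) : R[i] :=
  mu * ((z - a) / (conjc a * z - 1)).

(* g : R -> R is a lift, through x |-> e^(ix), of the restriction to the unit
   circle of an automorphism of the unit disc. *)
Definition is_automorphism_trace (R : realType) (g : R -> R) : Prop :=
  exists mu a : R[i], [/\ `|mu| = 1, `|a| < 1 &
    forall x : R, expi (g x) = disc_automorphism mu a (expi x)].

(* Phi t : R -> R is the lift of the time t flow map of the vector field
   X d/dx on the circle. *)
Definition is_flow (R : realType) (X : R -> R) (Phi : R -> R -> R) : Prop :=
  [/\ forall x : R, Phi 0 x = x,
      forall t x : R, Phi t (x + pi *+ 2) = Phi t x + pi *+ 2 &
      forall t x : R, is_derive t (1 : R) (fun s => Phi s x) (X (Phi t x))].

Definition flows_by_automorphisms (R : realType) (X : R -> R) : Prop :=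
  exists Phi : R -> R -> R,
    is_flow X Phi /\ forall t : R, is_automorphism_trace (Phi t).

(* The distribution u (d/dx)[((-Delta)^(1/2) u) X] *)
Definition product_derivative (R : realType) (u X phi : R -> R) : R :=
  - circle_int (fun x =>
      half_laplacian u x * X x * weak_derivative (u \* phi) x).

(* The distribution u (-Delta)^(1/2)(u' X) *)
Definition product_half_laplacian (R : realType) (u X phi : R -> R) : R :=
  circle_int (fun x =>
    weak_derivative u x * X x * half_laplacian (u \* phi) x).

(* Main.v *)
Require Import Defs.
From HB Require Import structures.
From mathcomp Require Import all_boot all_order all_algebra.
From mathcomp Require Import all_classical all_reals all_analysis.
From mathcomp Require Import measurable_realfun complex ring lra.

(** Write L for the half Laplacian.  The Fourier coefficient of L u + i u' at
    frequency n is (|n| - n) times that of u, so it vanishes for every n >= 0: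
    L u + i u' only contains negative frequencies.  The product of two such
    functions, coming from u and w, only contains frequencies <= -2, and is
    therefore orthogonal to every real trigonometric polynomial X of degree at
    most 1.  The imaginary part of this orthogonality reads
      int (L u) X w' + int u' X (L w) = 0,
    which is the distributional identity when w = u phi, and which gives the two
    integral identities when w = u and X = 1 or X = sin (x - delta).

    The functions at hand are only square-integrable, so a product of Fourier
    series has to be justified.  Both series attached to w are cut at the same
    frequencies and integrated term by term against (L u) X and u' X
    ([conjugate_pair_orthogonal]).  The cuts converge weakly by the Riesz-Fischer
    theorem ([riesz_fischer]), which also provides L w as a function, and the
    limits are the expected functions because a square-integrable function with
    vanishing Fourier coefficients is zero almost everywhere
    ([trig_coefs_eq0_ae]).

    The vector fields X of the statement have degree at most 1
    ([flows_by_automorphisms_trig]): with half angles, the points of the circle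
    and their images under an automorphism satisfy a linear relation between
    four functions, so that a 4 x 4 determinant vanishes along the flow;
    differentiating it at time 0 puts X in the span of 1, cos and sin. *)

Set Implicit Arguments.
Unset Strict Implicit.
Unset Printing Implicit Defensive.

Import Order.TTheory GRing.Theory Num.Theory.
Import numFieldNormedType.Exports.

Local Open Scope classical_set_scope.
Local Open Scope ring_scope.

(** * Integration over one period *)

Notation circle_itv := (`[0%R, pi *+ 2]%classic).

Definition circle_integrable (R : realType) (f : R -> R) : Prop :=
  (@lebesgue_measure R).-integrable circle_itv (EFin \o f).

Definition square_integrable (R : realType) (f : R -> R) : Prop :=
  measurable_fun setT f /\ circle_integrable (fun x => f x ^+ 2).

Section Integration.
Context {R : realType}.
Implicit Types f g h : R -> R.
Local Notation mu := (@lebesgue_measure R).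

Lemma twopi_gt0 : 0 < pi *+ 2 :> R.
Proof. by rewrite pmulrn_rgt0 // pi_gt0. Qed.

Lemma circle_itv_measurable : measurable (circle_itv : set R).
Proof. exact: measurable_itv. Qed.
Hint Resolve circle_itv_measurable : core.

Lemma circle_itv_finite : (mu circle_itv < +oo)%E.
Proof. by rewrite lebesgue_measure_itv/=; case: ifP => _; rewrite -?EFinB ltry. Qed.

Lemma circle_integrableD f g : circle_integrable f -> circle_integrable g ->
  circle_integrable (fun x => f x + g x).
Proof.
by move=> hf hg; apply: eq_integrable (integrableD _ hf hg).
Qed.

Lemma circle_integrableZ (a : R) f : circle_integrable f ->
  circle_integrable (fun x => a * f x).
Proof.
by move=> hf; apply: eq_integrable (integrableZl _ a hf).
Qed.

Lemma circle_integrable_sum (A : Type) (s : seq A) (F : A -> R -> R) :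
  (forall i, circle_integrable (F i)) ->
  circle_integrable (fun x => \sum_(i <- s) F i x).
Proof.
move=> hF; apply: eq_integrable (integrable_sum _ s (P := predT) (fun i _ => hF i)) => //.
by move=> x _ /=; rewrite sumEFin.
Qed.

Lemma circle_intD f g : circle_integrable f -> circle_integrable g ->
  circle_int (fun x => f x + g x) = circle_int f + circle_int g.
Proof. by move=> hf hg; rewrite /circle_int RintegralD. Qed.

Lemma circle_intZ (a : R) f : circle_integrable f ->
  circle_int (fun x => a * f x) = a * circle_int f.
Proof. by move=> hf; rewrite /circle_int RintegralZl. Qed.

Lemma circle_int0 : circle_int (fun=> 0 : R) = 0.
Proof. by rewrite /circle_int Rintegral_cst ?mul0r. Qed.

Lemma circle_int_sum (A : Type) (s : seq A) (F : A -> R -> R) :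
  (forall i, circle_integrable (F i)) ->
  circle_int (fun x => \sum_(i <- s) F i x) = \sum_(i <- s) circle_int (F i).
Proof.
move=> hF; elim: s => [|i s ih].
  under eq_fun do rewrite big_nil.
  by rewrite big_nil circle_int0.
under eq_fun do rewrite big_cons.
rewrite big_cons circle_intD ?ih//.
exact: circle_integrable_sum.
Qed.

Lemma circle_int_ae f g : circle_integrable g -> measurable_fun setT f ->
  {ae mu, forall x, circle_itv x -> f x = g x} -> circle_int f = circle_int g.
Proof.
move=> hg mf fg; rewrite /circle_int /Rintegral; congr fine.
apply: ae_eq_integral => //.
- by apply/measurable_EFinP; exact: measurable_funS mf.
- exact: measurable_int hg.
- move: fg; apply: filterS; first exact: (ae_filter_ringOfSetsType mu).
  by move=> x + Dx => /(_ Dx) /= ->.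
Qed.

Lemma circle_integrable_le f g : measurable_fun setT f -> circle_integrable g ->
  (forall x, circle_itv x -> `|f x| <= `|g x|) -> circle_integrable f.
Proof.
move=> mf hg fg; apply: le_integrable hg => //.
by apply/measurable_EFinP; exact: measurable_funS mf.
Qed.

Lemma circle_integrable_bounded (M : R) f : measurable_fun setT f ->
  (forall x, circle_itv x -> `|f x| <= M) -> circle_integrable f.
Proof.
move=> mf fM; apply: measurable_bounded_integrable => //.
- exact: circle_itv_finite.
- exact: measurable_funS mf.
- exists M; split; first exact: num_real.
  by move=> y My x Dx; exact: le_trans (fM _ Dx) (ltW My).
Qed.

Lemma square_integrableM f g : square_integrable f -> square_integrable g ->
  circle_integrable (fun x => f x * g x).
Proof.
move=> [mf f2] [mg g2].
apply: (circle_integrable_le _ (circle_integrableD f2 g2)).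
  exact: measurable_funM.
move=> x _; rewrite [leRHS]ger0_norm ?addr_ge0 ?sqr_ge0//.
by rewrite ler_norml; apply/andP; split; nra.
Qed.

Lemma square_integrableD f g : square_integrable f -> square_integrable g ->
  square_integrable (fun x => f x + g x).
Proof.
move=> hf hg; split; first exact: measurable_funD hf.1 hg.1.
under eq_fun do rewrite sqrrD -mulr_natl.
apply: circle_integrableD hg.2; apply: circle_integrableD hf.2 _.
exact/circle_integrableZ/square_integrableM.
Qed.

Lemma square_integrable_bounded (M : R) f : measurable_fun setT f ->
  (forall x, circle_itv x -> `|f x| <= M) -> square_integrable f.
Proof.
move=> mf fM; split=> //; apply: (@circle_integrable_bounded (M ^+ 2)).
  exact: measurable_funX.
move=> x Dx; rewrite normrX ler_pXn2r ?nnegrE ?fM//.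
by rewrite (le_trans _ (fM _ Dx)).
Qed.

Lemma square_integrableM_bounded (M : R) f g : square_integrable f ->
  measurable_fun setT g -> (forall x, circle_itv x -> `|g x| <= M) ->
  square_integrable (fun x => f x * g x).
Proof.
move=> hf mg gM; split; first exact: measurable_funM hf.1 mg.
apply: (circle_integrable_le _ (circle_integrableZ (M ^+ 2) hf.2)).
  by apply: measurable_funX; apply: measurable_funM hf.1 mg.
move=> x Dx; rewrite exprMn [f x ^+ 2 * _]mulrC !normrM ler_wpM2r//.
have gM' : `|g x| <= `|M| := le_trans (gM _ Dx) (ler_norm M).
by rewrite ler_pM.
Qed.

Lemma square_integrableZ (a : R) f : square_integrable f ->
  square_integrable (fun x => a * f x).
Proof.
move=> hf; under eq_fun do rewrite mulrC.
exact: (square_integrableM_bounded (M := `|a|)).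
Qed.

Lemma square_integrable1 f : square_integrable f -> circle_integrable f.
Proof.
move=> hf; have -> : f = (fun x => f x * 1) by apply/funext => x; rewrite mulr1.
apply: square_integrableM => //.
by apply: (@square_integrable_bounded 1) => // x _; rewrite normr1.
Qed.

Lemma continuous_bounded f : continuous f ->
  exists M, forall x, circle_itv x -> `|f x| <= M.
Proof.
move=> cf.
have cK : compact (circle_itv : set R) by exact: segment_compact.
have cfI : {within circle_itv, continuous f} by exact: continuous_subspaceT.
have [M [_ hM]] := compact_bounded (continuous_compact cfI cK).
exists (M + 1) => x Dx; apply: hM; first by rewrite ltrDl.
by exists x.
Qed.

Lemma continuous_measurable f : continuous f -> measurable_fun setT f.
Proof. exact: continuous_measurable_fun. Qed.

Lemma continuous_square_integrable f : continuous f -> square_integrable f.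
Proof.
move=> cf; have [M hM] := continuous_bounded cf.
by apply: square_integrable_bounded hM; exact: continuous_measurable.
Qed.

Lemma square_integrableM_continuous f g : square_integrable f -> continuous g ->
  square_integrable (fun x => f x * g x).
Proof.
move=> hf cg; have [M hM] := continuous_bounded cg.
by apply: square_integrableM_bounded hM => //; exact: continuous_measurable.
Qed.

Lemma L2_circle_square_integrable f : L2_circle f -> square_integrable f.
Proof. by case. Qed.

End Integration.
#[global] Hint Resolve circle_itv_measurable : core.

(** * Completeness of the trigonometric system *)

(** The frequency-n modes are kept in this real form because products with
    modes of lower frequency then stay within frequencies that are natural
    numbers, see [trig_modeM]. *)
Definition trig_mode (R : realType) (a b : R) (n : nat) (x : R) : R :=
  a * cos (n%:R * x) + b * sin (n%:R * x).

Section Completeness.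
Context {R : realType}.
Implicit Types f g h : R -> R.
Local Notation mu := (@lebesgue_measure R).

(** Dominated convergence, in the form used for every passage to the limit
    below. *)
Lemma cvg_circle_int (f_ : nat -> R -> R) f g :
  (forall n, measurable_fun setT (f_ n)) -> measurable_fun setT f ->
  circle_integrable g ->
  {ae mu, forall x, circle_itv x -> f_ ^~ x @ \oo --> f x} ->
  {ae mu, forall x, circle_itv x -> forall n, `|f_ n x| <= g x} ->
  circle_int (f_ n) @[n --> \oo] --> circle_int f.
Proof.
move=> mf_ mf ig f_f f_g.
have m1 n : measurable_fun circle_itv (EFin \o f_ n).
  by apply/measurable_EFinP; exact: measurable_funS (mf_ n).
have m2 : measurable_fun circle_itv (EFin \o f).
  by apply/measurable_EFinP; exact: measurable_funS mf.
have c1 : {ae mu, forall x, circle_itv x ->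
    (EFin \o f_ n) x @[n --> \oo] --> (EFin \o f) x}.
  move: f_f; apply: filterS; first exact: (ae_filter_ringOfSetsType mu).
  by move=> x /= + Dx => /(_ Dx) h; apply: cvg_EFin => //; exact: nearW.
have c2 : {ae mu, forall x, forall n, circle_itv x ->
    (`|(EFin \o f_ n) x| <= (EFin \o g) x)%E}.
  move: f_g; apply: filterS; first exact: (ae_filter_ringOfSetsType mu).
  by move=> x /= h n /h /(_ n); rewrite lee_fin.
have [ihf _] := @dominated_convergence _ _ R mu _ circle_itv_measurable
  _ _ _ m1 m2 c1 ig c2.
rewrite /= -[X in _ --> X]fineK; last exact: integrable_fin_num.
by move=> /fine_cvgP[_].
Qed.


Lemma bernoulli_ge (x : R) m : 0 <= x <= 1 -> 1 - m%:R * x <= (1 - x) ^+ m.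
Proof.
move=> /andP[x0 x1]; elim: m => [|m ih]; first by rewrite mul0r subr0 expr0.
rewrite exprS.
have : (1 - x) * (1 - m%:R * x) <= (1 - x) * (1 - x) ^+ m.
  by rewrite ler_wpM2l// subr_ge0.
apply: le_trans; rewrite -natr1.
have : 0 <= m%:R * (x * x) by rewrite !mulr_ge0.
lra.
Qed.

Lemma bernoulli_le (x : R) m : 0 <= x <= 1 -> (1 - x) ^+ m * (1 + m%:R * x) <= 1.
Proof.
move=> /andP[x0 x1]; elim: m => [|m ih]; first by rewrite mul0r addr0 expr0 mulr1.
apply: le_trans ih.
rewrite exprSr -mulrA ler_wpM2l ?exprn_ge0 ?subr_ge0// -natr1.
have : 0 <= m%:R * (x * x) by rewrite !mulr_ge0.
nra.
Qed.

(** The polynomials (1 - s^n)^m with m close to r^-n: since m s^n is then close to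
    (s / r)^n, they converge boundedly on [0, 1] to the indicator of s < r. *)
Definition cutoff_exponent (r : R) (n : nat) : nat := (Num.truncn (r^-1 ^+ n)).+1.

Definition cutoff (r : R) (n : nat) : {poly R} :=
  (1 - 'X^(n.+1)) ^+ cutoff_exponent r n.+1.

Lemma cutoffE r n (s : R) :
  (cutoff r n).[s] = (1 - s ^+ n.+1) ^+ cutoff_exponent r n.+1.
Proof. by rewrite /cutoff horner_exp hornerD hornerN hornerXn hornerC. Qed.

Lemma cutoff_itv r n (s : R) : 0 <= s <= 1 -> 0 <= (cutoff r n).[s] <= 1.
Proof.
move=> /andP[s0 s1]; rewrite cutoffE.
have h : 0 <= 1 - s ^+ n.+1 <= 1.
  by rewrite subr_ge0 exprn_ile1//= gerBl exprn_ge0.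
by case/andP: h => h0 h1; rewrite exprn_ge0// exprn_ile1.
Qed.

(** By Bernoulli's inequality the cutoff is at least 1 - m s^n, and m s^n is at
    most (s / r)^n + s^n. *)
Lemma cvg_cutoff1 (r s : R) : 0 <= s -> s < r -> r < 1 ->
  (cutoff r n).[s] @[n --> \oo] --> (1 : R).
Proof.
move=> s0 sr r1.
have r0 : 0 < r by exact: le_lt_trans sr.
have s1 : s < 1 by exact: lt_trans r1.
have geo (z : R) : 0 <= z -> z < 1 -> (z ^+ n.+1 @[n --> \oo] --> (0 : R)).
  move=> z0 z1; rewrite (cvg_shiftS (GRing.exp z)).
  by apply: cvg_expr; rewrite ger0_norm.
apply: (@squeeze_cvgr _ _ _ _ (fun n => 1 - ((s / r) ^+ n.+1 + s ^+ n.+1)) (fun=> 1)).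
- apply: nearW => n.
  have /andP[_ ->] : 0 <= (cutoff r n).[s] <= 1 by rewrite cutoff_itv// s0 ltW.
  rewrite andbT cutoffE.
  apply: le_trans (bernoulli_ge _ _); last by rewrite exprn_ge0//= exprn_ile1// ltW.
  rewrite lerD2l lerN2 expr_div_n -[leRHS]mul1r.
  rewrite [s ^+ _ / _]mulrC -[X in _ + X]mul1r -mulrDl mul1r ler_wpM2r ?exprn_ge0//.
  rewrite /cutoff_exponent -natr1 lerD2r -exprVn.
  by have /andP[] := truncn_itv (exprn_ge0 n.+1 (ltW (divr_gt0 ltr01 r0))); rewrite mul1r.
- rewrite -[X in _ --> X]subr0; apply: cvgB; first exact: cvg_cst.
  rewrite -[X in _ --> X]addr0; apply: cvgD; apply: geo => //.
    by rewrite divr_ge0// ltW.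
  by rewrite ltr_pdivrMr// mul1r.
- exact: cvg_cst.
Qed.

(** The cutoff is at most 1 / (1 + m s^n), and m s^n is at least (s / r)^n. *)
Lemma cvg_cutoff0 (r s : R) : 0 < r -> r < s -> s <= 1 ->
  (cutoff r n).[s] @[n --> \oo] --> (0 : R).
Proof.
move=> r0 rs s1.
have s0 : 0 < s by exact: lt_trans rs.
have geo (z : R) : 0 <= z -> z < 1 -> (z ^+ n.+1 @[n --> \oo] --> (0 : R)).
  move=> z0 z1; rewrite (cvg_shiftS (GRing.exp z)).
  by apply: cvg_expr; rewrite ger0_norm.
apply: (@squeeze_cvgr _ _ _ _ (fun=> 0) (fun n => (r / s) ^+ n.+1)).
- apply: nearW => n.
  have /andP[-> _] : 0 <= (cutoff r n).[s] <= 1 by rewrite cutoff_itv// s1 ltW.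
  rewrite /= cutoffE.
  set x := s ^+ n.+1; set m := cutoff_exponent _ _.
  have x01 : 0 <= x <= 1 by rewrite exprn_ge0 ?exprn_ile1// ltW.
  have rx : 0 < r ^+ n.+1 by rewrite exprn_gt0.
  have xp : 0 < x by rewrite exprn_gt0.
  have hm : x / r ^+ n.+1 <= 1 + m%:R * x.
    rewrite mulrC -[leLHS]add0r lerD// ler_wpM2r// ?(ltW xp)// -exprVn ltW//.
    exact: truncnS_gt.
  rewrite expr_div_n -/x.
  have := bernoulli_le m x01.
  have P0 : 0 <= (1 - x) ^+ m by rewrite exprn_ge0// subr_ge0; case/andP: x01.
  move=> h; have {h} : (1 - x) ^+ m * (x / r ^+ n.+1) <= 1.
    by apply: le_trans h; rewrite ler_wpM2l.
  by rewrite mulrA ler_pdivrMr// mul1r ler_pdivlMr.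
- exact: cvg_cst.
- by apply: geo; rewrite ?divr_ge0 ?ltW// ltr_pdivrMr// mul1r.
Qed.


Lemma trig_modeM (a b c d : R) n m x : (m <= n)%N ->
  trig_mode a b n x * trig_mode c d m x =
  trig_mode ((a * c - b * d) / 2) ((a * d + b * c) / 2) (n + m) x +
  trig_mode ((a * c + b * d) / 2) ((b * c - a * d) / 2) (n - m) x.
Proof.
move=> mn; rewrite /trig_mode.
have -> : (n + m)%:R * x = n%:R * x + m%:R * x by rewrite natrD mulrDl.
have -> : (n - m)%:R * x = n%:R * x - m%:R * x by rewrite natrB// mulrBl.
by rewrite cosD sinD cosB sinB; field.
Qed.

Lemma trig_modeZ (a b c : R) n x : c * trig_mode a b n x = trig_mode (c * a) (c * b) n x.
Proof. by rewrite /trig_mode; ring. Qed.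

Lemma trig_mode0 (a b : R) x : trig_mode a b 0 x = a.
Proof. by rewrite /trig_mode mul0r cos0 sin0 mulr0 mulr1 addr0. Qed.

Lemma trig_mode_continuous (a b : R) n : continuous (trig_mode a b n).
Proof.
have cn : continuous (fun x : R => n%:R * x).
  by move=> x; apply: cvgM; [exact: cvg_cst|exact: cvg_id].
move=> x; apply: cvgD; apply: cvgM; try exact: cvg_cst.
  by apply: (@continuous_comp R R R _ (@cos R) x (cn x)); exact: continuous_cos.
by apply: (@continuous_comp R R R _ (@sin R) x (cn x)); exact: continuous_sin.
Qed.

Lemma trig_mode_square_integrable (a b : R) n : square_integrable (trig_mode a b n).
Proof. exact/continuous_square_integrable/trig_mode_continuous. Qed.

(** Trigonometric polynomials as an inductive predicate: orthogonality to all of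
    them then follows from orthogonality to the modes by structural induction. *)
Inductive trig_poly : (R -> R) -> Prop :=
| trig_poly_mode a b n : trig_poly (trig_mode a b n)
| trig_polyD f g : trig_poly f -> trig_poly g -> trig_poly (fun x => f x + g x).

Lemma trig_poly_eq f g : f =1 g -> trig_poly f -> trig_poly g.
Proof. by move=> /funext ->. Qed.

Lemma trig_poly_cst a : trig_poly (fun=> a).
Proof. by apply: trig_poly_eq (trig_poly_mode a 0 0) => x; exact: trig_mode0. Qed.

Lemma trig_polyZ c f : trig_poly f -> trig_poly (fun x => c * f x).
Proof.
elim=> {f} [a b n|f g _ hf _ hg].
  by apply: trig_poly_eq (trig_poly_mode (c * a) (c * b) n) => x; rewrite trig_modeZ.
by apply: trig_poly_eq (trig_polyD hf hg) => x; rewrite mulrDr.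
Qed.

Lemma trig_polyM_mode1 c d f : trig_poly f -> trig_poly (fun x => f x * trig_mode c d 1 x).
Proof.
elim=> {f} [a b [|n]|f g _ hf _ hg].
- apply: trig_poly_eq (trig_poly_mode (a * c) (a * d) 1) => x.
  by rewrite trig_mode0 trig_modeZ.
- by apply: trig_poly_eq (trig_polyD (trig_poly_mode _ _ _) (trig_poly_mode _ _ _)) => x;
    rewrite trig_modeM.
- by apply: trig_poly_eq (trig_polyD hf hg) => x; rewrite mulrDl.
Qed.

(** An affine function of cos (x - c) with values in [0, 1]: the arcs centred at
    e^(ic) are its superlevel sets, so composing it with [cutoff] yields
    trigonometric polynomials that converge to the indicator of an arc. *)
Definition arc_height (c x : R) : R := (1 + cos (x - c)) / 2.

(** Horner's scheme only multiplies by modes of frequency at most 1. *)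
Lemma trig_poly_horner (c : R) (p : {poly R}) :
  trig_poly (fun x => p.[arc_height c x]).
Proof.
elim/poly_ind: p => [|p a ih].
  by apply: trig_poly_eq (trig_poly_cst 0) => x; rewrite horner0.
have hm := trig_polyM_mode1 (cos c / 2) (sin c / 2) ih.
apply: trig_poly_eq (trig_polyD (trig_polyD (trig_polyZ 2^-1 ih) hm) (trig_poly_cst a)) => x.
by rewrite hornerMXaddC /arc_height /trig_mode mul1r cosB; field.
Qed.

Lemma trig_poly_continuous f : trig_poly f -> continuous f.
Proof.
elim=> {f} [a b n|f g _ hf _ hg]; first exact: trig_mode_continuous.
by move=> x; apply: cvgD; [exact: hf|exact: hg].
Qed.

Lemma trig_poly_orthogonal h f : square_integrable h ->
  (forall a b n, circle_int (fun x => h x * trig_mode a b n x) = 0) ->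
  trig_poly f -> circle_int (fun x => h x * f x) = 0.
Proof.
move=> hh hm; elim=> {f} [//|f g tf ihf tg ihg].
have hi k : trig_poly k -> circle_integrable (fun x => h x * k x).
  move=> tk; apply: square_integrableM => //.
  exact/continuous_square_integrable/trig_poly_continuous.
under eq_fun do rewrite mulrDr.
by rewrite circle_intD ?ihf ?ihg ?addr0//; exact: hi.
Qed.

Lemma arc_height_in (y x : R) : 0 < y < pi *+ 2 -> 0 < x < y ->
  arc_height (y / 2) 0 < arc_height (y / 2) x.
Proof.
move=> /andP[y0 y2] /andP[x0 xy]; rewrite /arc_height ltr_pM2r ?invr_gt0// ltrD2l sub0r cosN.
rewrite -(cos_norm (x - _)) ltr_cos//; first by rewrite ltr_norml; apply/andP; split; lra.
- by rewrite in_itv/= normr_ge0 ler_norml; apply/andP; split; lra.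
- by rewrite in_itv/=; apply/andP; split; lra.
Qed.

Lemma arc_height_out (y x : R) : 0 < y -> y < x < pi *+ 2 ->
  arc_height (y / 2) x < arc_height (y / 2) 0.
Proof.
move=> y0 /andP[yx x2]; rewrite /arc_height ltr_pM2r ?invr_gt0// ltrD2l sub0r cosN.
have [xpi|xpi] := leP (x - y / 2) pi.
  by rewrite ltr_cos ?in_itv/=; lra.
rewrite -cosN -cosD2pi ltr_cos ?in_itv/=; lra.
Qed.

Lemma arc_height_itv (c x : R) : 0 <= arc_height c x <= 1.
Proof.
have := cos_geN1 (x - c); have := cos_le1 (x - c).
by rewrite /arc_height; lra.
Qed.


Lemma ae_neq (a : R) : {ae mu, forall x, x != a}.
Proof.
exists [set a]; split=> //=; first exact: lebesgue_measure_set1.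
by move=> x /= /negP; rewrite negbK => /eqP.
Qed.

(** The indicator of [0, y] is a bounded pointwise limit of the trigonometric
    polynomials 1 - cutoff, except at the three points 0, y and 2 pi. *)
Lemma int_initial_segment_eq0 h (y : R) : square_integrable h ->
  (forall a b n, circle_int (fun x => h x * trig_mode a b n x) = 0) ->
  0 < y < pi *+ 2 -> \int[mu]_(x in `[0, y]) h x = 0.
Proof.
move=> hh hm /[dup] y02 /andP[y0 y2].
have tp p : trig_poly (fun x => p.[arc_height (y / 2) x]) by exact: trig_poly_horner.
set r := arc_height (y / 2) 0.
have r0 : 0 < r.
  apply: le_lt_trans (@arc_height_out y (y / 2 + pi) y0 _); last by lra.
  by have /andP[] := arc_height_itv (y / 2) (y / 2 + pi).
have r1 : r < 1.
  apply: lt_le_trans (@arc_height_in y (y / 2) y02 _) _; first by lra.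
  by have /andP[] := arc_height_itv (y / 2) (y / 2).
have nz n : circle_int (fun x => h x * (1 - (cutoff r n).[arc_height (y / 2) x])) = 0.
  apply: trig_poly_orthogonal => //.
  apply: trig_poly_eq (trig_polyD (trig_poly_cst 1) (trig_polyZ (-1) (tp (cutoff r n)))) => x.
  by rewrite mulN1r.
have lim : circle_int (fun x => h x * (1 - (cutoff r n).[arc_height (y / 2) x])) @[n --> \oo]
    --> circle_int (fun x => h x * \1_`[0, y] x).
  have mc n : measurable_fun setT (fun x => 1 - (cutoff r n).[arc_height (y / 2) x]).
    apply: measurable_funB => //; apply: continuous_measurable.
    exact/trig_poly_continuous/tp.
  apply: (@cvg_circle_int _ _ (fun x => `|h x|)).
  - by move=> n; apply: measurable_funM => //; exact: hh.1.
  - by apply: measurable_funM => //; exact: hh.1.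
  - exact/integrable_norm/square_integrable1.
  - apply: (@filterS3 _ _ (ae_filter_ringOfSetsType mu) _ _ _ _ _
      (ae_neq 0) (ae_neq y) (ae_neq (pi *+ 2))).
    move=> x x0 xy x2 /=; rewrite in_itv/= => xI.
    apply: cvgM; first exact: cvg_cst.
    have [xly|ylx] := ltP x y.
      have -> : \1_`[0, y] x = 1 - 0 :> R.
        by rewrite indicE mem_set ?subr0//= in_itv/=; lra.
      apply: cvgB; first exact: cvg_cst.
      apply: cvg_cutoff0 => //; last by have /andP[] := arc_height_itv (y / 2) x.
      by apply: arc_height_in => //; rewrite xly andbT lt_neqAle eq_sym x0; case/andP: xI.
    have {}ylx : y < x by rewrite lt_neqAle eq_sym xy.
    have -> : \1_`[0, y] x = 1 - 1 :> R.
      by rewrite indicE memNset ?subrr//= in_itv/=; lra.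
    apply: cvgB; first exact: cvg_cst.
    apply: cvg_cutoff1 => //; first by have /andP[] := arc_height_itv (y / 2) x.
    by apply: arc_height_out => //; rewrite ylx lt_neqAle x2; case/andP: xI.
  - apply: (@filterS _ _ (ae_filter_ringOfSetsType mu) _ _ _ (ae_neq 0)) => x _ _ n.
    rewrite normrM ler_piMr// ger0_norm.
      by have := cutoff_itv r n (arc_height_itv (y / 2) x); lra.
    by have := cutoff_itv r n (arc_height_itv (y / 2) x); lra.
have := lim; under eq_fun do rewrite nz.
move=> /(cvg_lim (@Rhausdorff R)); rewrite lim_cst; last exact: Rhausdorff.
move=> E; have yI : `[0, y]%classic = circle_itv `&` `[0, y]%classic :> set R.
  by rewrite setIidr// => x /=; rewrite !in_itv/=; lra.
by rewrite yI Rintegral_mkcondr patch_indic [RHS]E.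
Qed.

(** The primitive of h from 0 vanishes by [int_initial_segment_eq0], and h is almost
    everywhere its derivative by Lebesgue's differentiation theorem. *)
Lemma trig_coefs_eq0_ae h : square_integrable h ->
  (forall a b n, circle_int (fun x => h x * trig_mode a b n x) = 0) ->
  {ae mu, forall x, circle_itv x -> h x = 0}.
Proof.
move=> hh hm.
pose h0 := h \_ circle_itv.
have ih : circle_integrable h by exact: square_integrable1.
have loc : locally_integrable setT h0 by exact: integrable_locally.
have ih0 : mu.-integrable setT (EFin \o h0).
  by move: ih; rewrite /circle_integrable integrable_mkcond// restrict_EFin.
have ih0y z : mu.-integrable [set` Interval (BLeft 0) (BRight z)] (EFin \o h0).
  exact: integrableS ih0.
have := FTC1 ih0y loc.
set F := fun x : R => _; move=> hF.
apply: (@filterS3 _ _ (ae_filter_ringOfSetsType mu) _ _ _ _ _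
  hF (ae_neq 0) (ae_neq (pi *+ 2))) => x + x0 x2 xI.
have {x0 x2}xlt : 0 < x < pi *+ 2.
  by move: xI; rewrite /= in_itv/= !lt_neqAle eq_sym x0 x2.
case/andP: (xlt) => x0 x2 /=.
have bx : (0%:E < x%:E)%E by rewrite lte_fin.
move=> /(_ bx)[_].
have -> : h0 x = h x by rewrite /h0 patchE mem_set.
move=> <-; rewrite derive1E.
have -> : 'D_1 F x = 'D_1 (cst 0) x.
  apply: near_eq_derive.
  have : \forall z \near x, z \in `]0, pi *+ 2[ by exact: near_in_itvoo.
  apply: filterS => z; rewrite in_itv/= => z02.
  rewrite /F -[RHS](int_initial_segment_eq0 hh hm z02).
  apply: eq_Rintegral => w; rewrite inE/= in_itv/= => w0z.
  rewrite /h0 patchE mem_set//= in_itv/=; lra.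
by rewrite derive_cst.
Qed.

End Completeness.

(** * The Riesz-Fischer theorem *)

Section RieszFischer.
Context {R : realType}.
Implicit Types f g h : R -> R.
Local Notation mu := (@lebesgue_measure R).

Lemma sum_half_powers n : \sum_(0 <= j < n) (2^-1 : R) ^+ j = 2 - 2 * 2^-1 ^+ n.
Proof.
elim: n => [|n ih]; first by rewrite big_nil expr0 mulr1 subrr.
by rewrite big_nat_recr//= ih exprS; field.
Qed.

(** A series of functions whose squared norms decay like 4^-j.  The function
    G = sum_j 2^j B_j^2 is integrable, and where it is finite it controls all
    partial sums of |B_j|: the series converges absolutely there and a constant
    plus a multiple of G serves as a dominating function. *)
Section RapidSeries.
Variables (B : nat -> R -> R) (K : R).
Hypothesis B_circle : forall j, on_circle (B j).
Hypothesis B_sq : forall j, square_integrable (B j).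
Hypothesis B_small : forall j, circle_int (fun x => B j x ^+ 2) <= K * 4^-1 ^+ j.

Let K_ge0 : 0 <= K.
Proof.
have := B_small 0; rewrite expr0 mulr1; apply: le_trans.
by apply: Rintegral_ge0 => x _; exact: sqr_ge0.
Qed.

Let G (x : R) : \bar R := (\sum_(0 <= j <oo) (2 ^+ j * B j x ^+ 2)%:E)%E.
Let D : set R := [set x | (G x < +oo)%E].
Let g (x : R) : R := fine (G x).

Let term_ge0 j x : (0 <= (2 ^+ j * B j x ^+ 2)%:E)%E.
Proof. by rewrite lee_fin mulr_ge0// sqr_ge0. Qed.

Let G_ge0 x : (0 <= G x)%E.
Proof. exact: nneseries_ge0. Qed.

Let g_ge0 x : 0 <= g x.
Proof. exact: fine_ge0. Qed.

Let mterm j : measurable_fun setT (fun x => (2 ^+ j * B j x ^+ 2)%:E).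
Proof.
apply/measurable_EFinP; apply: measurable_funM => //.
by apply: measurable_funX; exact: (B_sq j).1.
Qed.

Let mG : measurable_fun setT G.
Proof. by apply: ge0_emeasurable_sum => // j x _ _; exact: term_ge0. Qed.

Let mD : measurable D.
Proof.
rewrite /D -[X in measurable X]setTI.
exact: emeasurable_fun_infty_o.
Qed.

Let mg : measurable_fun setT g.
Proof. exact: measurableT_comp. Qed.

Let iG : mu.-integrable circle_itv G.
Proof.
apply/integrableP; split; first exact: measurable_funS mG.
under eq_integral do rewrite gee0_abs//.
rewrite /G integral_nneseries//; last by move=> j; exact: measurable_funS (mterm j).
apply: (@le_lt_trans _ _ (2 * K)%:E); last exact: ltry.
apply: lime_le; first by apply: is_cvg_nneseries => j _ _; exact: integral_ge0.
apply: nearW => n.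
apply: (@le_trans _ _ (\sum_(0 <= j < n) (K * 2^-1 ^+ j)%:E)%E).
  apply: lee_sum => j _.
  have ij : circle_integrable (fun x => 2 ^+ j * B j x ^+ 2).
    by apply: circle_integrableZ; exact: (B_sq j).2.
  rewrite -[leLHS]fineK; last exact: integrable_fin_num.
  rewrite lee_fin -[leLHS]/(circle_int (fun x => 2 ^+ j * B j x ^+ 2)).
  rewrite circle_intZ; last exact: (B_sq j).2.
  apply: (@le_trans _ _ (2 ^+ j * (K * 4^-1 ^+ j))); first by rewrite ler_wpM2l.
  rewrite mulrCA -exprMn ler_wpM2l//.
  by rewrite (_ : 2 * 4^-1 = 2^-1 :> R)//; field.
rewrite sumEFin lee_fin -mulr_sumr sum_half_powers mulrC.
by rewrite ler_wpM2r// gerBl mulr_ge0.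
Qed.

Let aeD : {ae mu, forall x, circle_itv x -> D x}.
Proof.
apply: (@filterS _ _ (ae_filter_ringOfSetsType mu) _ _ _
  (@integrable_ae _ _ R mu _ circle_itv_measurable _ iG)).
by move=> x + Dx => /(_ Dx); rewrite /D /= -ge0_fin_numE.
Qed.

Let ig : circle_integrable g.
Proof.
apply: le_integrable iG => //.
  by apply/measurable_EFinP; exact: measurable_funS mg.
move=> x _; rewrite /= ger0_norm// gee0_abs//.
have [Gx|] := boolP (G x \is a fin_num); first by rewrite /g fineK.
by rewrite ge0_fin_numE// -leNgt leye_eq => /eqP ->; rewrite leey.
Qed.

(* AM-GM, 2 |B_j| <= t 2^-j + 2^j B_j^2 / t, summed over j at t = sqrt (1 + g);
   the summand 1 keeps t positive. *)
Let bound n x : D x -> \sum_(0 <= j < n) `|B j x| <= 2 * Num.sqrt (1 + g x).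
Proof.
move=> Dx; set t := Num.sqrt (1 + g x).
have t2 : t ^+ 2 = 1 + g x by rewrite sqr_sqrtr// addr_ge0.
have t0 : 0 < t by rewrite sqrtr_gt0 ltr_pwDl.
have hg : \sum_(0 <= j < n) 2 ^+ j * B j x ^+ 2 <= g x.
  rewrite -lee_fin /g fineK; last by rewrite ge0_fin_numE.
  by rewrite -sumEFin; exact: nneseries_lim_ge.
apply: (@le_trans _ _ (\sum_(0 <= j < n) (t / 2 * 2^-1 ^+ j
    + (2 * t)^-1 * (2 ^+ j * B j x ^+ 2)))).
  apply: ler_sum => j _.
  have p0 : 0 < (2 : R) ^+ j by rewrite exprn_gt0.
  rewrite exprVn.
  set p := 2 ^+ j in p0 *.
  have -> : t / 2 / p + (2 * t)^-1 * (p * B j x ^+ 2)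
     = `|B j x| + (p * `|B j x| - t) ^+ 2 / (2 * t * p).
    rewrite -(real_normK (num_real (B j x))).
    by field; rewrite !gt_eqF.
  by rewrite lerDl divr_ge0 ?sqr_ge0// !mulr_ge0// ltW.
rewrite big_split/= -!mulr_sumr sum_half_powers.
have h1 : t / 2 * (2 - 2 * 2^-1 ^+ n) <= t.
  have -> : t / 2 * (2 - 2 * 2^-1 ^+ n) = t - t * 2^-1 ^+ n by field.
  by rewrite gerBl mulr_ge0 ?exprn_ge0// ltW.
have h2 : (2 * t)^-1 * (\sum_(0 <= j < n) 2 ^+ j * B j x ^+ 2) <= t.
  rewrite mulrC ler_pdivrMr ?mulr_gt0//; apply: le_trans hg _.
  by have := g_ge0 x; nra.
rewrite [leRHS](_ : _ = t + t); last by ring.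
exact: lerD.
Qed.

Let S n x := \sum_(0 <= j < n) B j x * \1_D x.

Let S_out n x : ~ D x -> S n x = 0.
Proof.
by move=> Dx; rewrite /S big1// => j _; rewrite indicE memNset// mulr0.
Qed.

Let S_in n x : D x -> S n x = \sum_(0 <= j < n) B j x.
Proof.
by move=> Dx; apply: eq_bigr => j _; rewrite indicE mem_set// mulr1.
Qed.

Let S_sq n x : S n x ^+ 2 <= 4 * (1 + g x).
Proof.
have [Dx|Dx] := pselect (D x); last first.
  by rewrite S_out// expr0n/= mulr_ge0// addr_ge0.
rewrite S_in// -real_normK ?num_real//.
have -> : 4 * (1 + g x) = (2 * Num.sqrt (1 + g x)) ^+ 2.
  by rewrite exprMn sqr_sqrtr ?addr_ge0//; ring.
rewrite ler_pXn2r ?nnegrE ?mulr_ge0 ?sqrtr_ge0//.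
exact: le_trans (ler_norm_sum _ _ _) (bound n Dx).
Qed.

Let S_cvg x : cvgn (S ^~ x).
Proof.
have [Dx|Dx] := pselect (D x); last first.
  by under eq_fun do rewrite S_out//; exact: is_cvg_cst.
under eq_fun do rewrite S_in//.
apply: normed_cvg.
apply: nondecreasing_is_cvgn.
  by apply: nondecreasing_series => j *; exact: normr_ge0.
by exists (2 * Num.sqrt (1 + g x)) => _ [n _ <-]; exact: bound.
Qed.

(** The limit is taken of the terms multiplied by the indicator of the set where G
    is finite: this sequence converges at every point, which gives a measurable
    limit, and the set is periodic, which gives a periodic one. *)
Lemma rapid_series_weak_limit : exists2 v : R -> R, L2_circle v &
  forall F, square_integrable F ->
    circle_int (fun x => F x * \sum_(0 <= j < n) B j x) @[n --> \oo]
      --> circle_int (fun x => F x * v x).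
Proof.
pose v x := lim (S ^~ x @ \oo).
have Sv x : S ^~ x @ \oo --> v x by exact: S_cvg.
have mS n : measurable_fun setT (S n).
  apply: measurable_sum => j; apply: measurable_funM => //; exact: (B_sq j).1.
have mv : measurable_fun setT v by apply: (measurable_fun_cvg mS) => x _; exact: Sv.
have v_sq x : v x ^+ 2 <= 4 * (1 + g x).
  have : (fun n => S n x ^+ 2) @ \oo --> v x ^+ 2.
    by rewrite expr2; apply: cvgM; exact: Sv.
  move=> h; rewrite -(cvg_lim (@Rhausdorff R) h); apply: limr_le.
    by apply/cvg_ex; exists (v x ^+ 2).
  by apply: nearW => n; exact: S_sq.
have ib : circle_integrable (fun x => 4 * (1 + g x)).
  apply: circle_integrableZ; apply: circle_integrableD ig.
  by apply: (@circle_integrable_bounded _ 1) => // x _; rewrite normr1.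
exists v.
  split=> //.
    move=> x; rewrite /v; congr (lim (_ @ \oo)); apply/funext => n.
    rewrite /S; apply: eq_bigr => j _; rewrite B_circle; congr (_ * _).
    rewrite !indicE; congr ((_ : bool)%:R); rewrite /D /G.
    by apply/asbool_equiv_eq => /=; under eq_eseriesr do rewrite B_circle.
  apply: (circle_integrable_le _ ib); first exact: measurable_funX.
  move=> x _; rewrite !ger0_norm ?sqr_ge0//.
  exact: le_trans (sqr_ge0 _) (v_sq x).
move=> F hF.
apply: (@cvg_circle_int _ _ _ (fun x => F x ^+ 2 + 4 * (1 + g x))).
- move=> n; apply: measurable_funM hF.1 _.
  by apply: measurable_sum => j; exact: (B_sq j).1.
- exact: measurable_funM hF.1 mv.
- exact: circle_integrableD hF.2 ib.
- move: aeD; apply: filterS; first exact: (ae_filter_ringOfSetsType mu).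
  move=> x + Ix => /(_ Ix) Dx; apply: cvgM; first exact: cvg_cst.
  by have := Sv x; under eq_fun do rewrite S_in//.
- move: aeD; apply: filterS; first exact: (ae_filter_ringOfSetsType mu).
  move=> x + Ix n => /(_ Ix) Dx; rewrite -S_in//.
  have := S_sq n x; rewrite ler_norml => h; apply/andP; split; nra.
Qed.

End RapidSeries.

Lemma circle_int_derive (F f : R -> R) : (forall x, is_derive x (1 : R) F (f x)) ->
  continuous f -> circle_int f = F (pi *+ 2) - F 0.
Proof.
move=> dF cf.
have cF : continuous F.
  by move=> x; apply/differentiable_continuous/derivable1_diffP; exact: ex_derive.
rewrite /circle_int /Rintegral (@continuous_FTC2 _ f F)//.
- exact: twopi_gt0.
- exact: continuous_subspaceT.
- split=> [x _||]; first exact: ex_derive.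
    exact: cvg_at_right_filter (cF 0).
  exact: cvg_at_left_filter (cF _).
- by move=> x _; rewrite derive1E; exact: derive_val.
Qed.

Lemma trig_mode_periodic (a b : R) n : on_circle (trig_mode a b n).
Proof.
move=> x; rewrite /trig_mode mulrDr.
have -> : n%:R * (pi *+ 2) = pi *+ 2 *+ n :> R by rewrite mulr_natl.
by rewrite (periodicn (@cosD2pi R)) (periodicn (@sinD2pi R)).
Qed.

Lemma is_derive_trig_mode (a b : R) n x :
  is_derive x (1 : R) (trig_mode a b n) (trig_mode (n%:R * b) (- (n%:R * a)) n x).
Proof.
rewrite /trig_mode; apply: is_derive_eq.
rewrite /GRing.scale/=; ring.
Qed.

Lemma circle_int_trig_mode (a b : R) n : circle_int (trig_mode a b n.+1) = 0.
Proof.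
have n0 : n.+1%:R != 0 :> R by rewrite pnatr_eq0.
have dF x : is_derive x (1 : R)
    (trig_mode (- (b / n.+1%:R)) (a / n.+1%:R) n.+1) (trig_mode a b n.+1 x).
  apply: (is_derive_eq (is_derive_trig_mode _ _ _ _)).
  by congr trig_mode; field; rewrite nat1r.
rewrite (circle_int_derive dF (@trig_mode_continuous _ _ _ _)).
by rewrite -[pi *+ 2]add0r trig_mode_periodic subrr.
Qed.

Lemma circle_int_cst (a : R) : circle_int (fun=> a) = a * (pi *+ 2).
Proof.
rewrite /circle_int Rintegral_cst//; congr (_ * _).
rewrite -[RHS]/(fine (pi *+ 2)%:E); congr fine; apply: etrans (lebesgue_measure_itv _) _.
by rewrite /= lte_fin twopi_gt0 -EFinB subr0.
Qed.

(** The product is a sum of modes of frequencies n + m + 2 and |n - m|, and only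
    frequency 0 has a nonzero integral. *)
Lemma circle_int_trig_modeM (a b c d : R) n m :
  circle_int (fun x => trig_mode a b n.+1 x * trig_mode c d m.+1 x) =
  if n == m then pi * (a * c + b * d) else 0.
Proof.
have int p q k : circle_integrable (trig_mode p q k).
  exact/square_integrable1/trig_mode_square_integrable.
wlog mn : a b c d n m / (m <= n)%N => [H|].
  have [|/ltnW nm] := leqP m n; first exact: H.
  rewrite eq_sym; under eq_fun do rewrite mulrC.
  by rewrite H//; case: ifP => // _; ring.
under eq_fun do rewrite trig_modeM//.
rewrite circle_intD// addSn circle_int_trig_mode add0r subSS.
have [<-|nm] := eqVneq n m.
  rewrite subnn (_ : trig_mode _ _ 0 = fun=> (a * c + b * d) / 2).
    by rewrite circle_int_cst; field.
  by apply/funext => x; rewrite trig_mode0.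
have -> : (n - m = (n - m).-1.+1)%N by rewrite prednK// subn_gt0 ltn_neqAle eq_sym nm.
exact: circle_int_trig_mode.
Qed.

Definition trig_sum (a b : nat -> R) (m n : nat) (x : R) : R :=
  \sum_(m <= k < n) trig_mode (a k) (b k) k.+1 x.

Lemma trig_sum_continuous a b m n : continuous (trig_sum a b m n).
Proof.
rewrite /trig_sum; elim: (index_iota m n) => [|k s ih].
  by under eq_fun do rewrite big_nil; move=> x; exact: cvg_cst.
under eq_fun do rewrite big_cons.
by move=> x; apply: cvgD; [exact: trig_mode_continuous|exact: ih].
Qed.

Lemma circle_intM_trig_sum h a b m n : square_integrable h ->
  circle_int (fun x => h x * trig_sum a b m n x) =
  \sum_(m <= k < n) circle_int (fun x => h x * trig_mode (a k) (b k) k.+1 x).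
Proof.
move=> hh; under eq_fun do rewrite mulr_sumr.
rewrite circle_int_sum// => k.
by apply: square_integrableM => //; exact: trig_mode_square_integrable.
Qed.

Lemma trig_sum_square_integrable a b m n : square_integrable (trig_sum a b m n).
Proof. exact/continuous_square_integrable/trig_sum_continuous. Qed.

Lemma circle_int_trig_mode_sum a b c d k m n :
  circle_int (fun x => trig_mode c d k.+1 x * trig_sum a b m n x) =
  if (m <= k < n)%N then pi * (a k * c + b k * d) else 0.
Proof.
rewrite circle_intM_trig_sum; last exact: trig_mode_square_integrable.
under eq_bigr do rewrite circle_int_trig_modeM.
case: ifPn => kmn.
  rewrite (bigD1_seq k) ?mem_index_iota ?iota_uniq//= eqxx big1 => [|i ik].
    by rewrite addr0; ring.
  by rewrite eq_sym (negbTE ik).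
rewrite big_nat big1// => i imn; case: eqP => // ki.
by rewrite ki imn in kmn.
Qed.

(** The modes of positive frequency are k.+1; the mean value is prescribed to be 0,
    as is the case for derivatives and half Laplacians. *)
Definition has_trig_coefs (f : R -> R) (a b : nat -> R) : Prop :=
  circle_int f = 0 /\
  forall k c d, circle_int (fun x => f x * trig_mode c d k.+1 x) = pi * (a k * c + b k * d).

Lemma circle_int_trig_sum_sq a b m n :
  circle_int (fun x => trig_sum a b m n x ^+ 2) =
  pi * \sum_(m <= k < n) (a k ^+ 2 + b k ^+ 2).
Proof.
under eq_fun do rewrite expr2.
rewrite circle_intM_trig_sum; last exact: trig_sum_square_integrable.
rewrite mulr_sumr; apply: eq_big_nat => k kmn.
under eq_fun do rewrite mulrC.
by rewrite circle_int_trig_mode_sum kmn !expr2.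
Qed.

(** Expand the integral of the square of f minus its partial Fourier sum. *)
Lemma bessel f a b n : square_integrable f -> has_trig_coefs f a b ->
  \sum_(0 <= k < n) (a k ^+ 2 + b k ^+ 2) <= pi^-1 * circle_int (fun x => f x ^+ 2).
Proof.
move=> hf [_ hab]; rewrite ler_pdivlMl ?pi_gt0//.
set S := trig_sum a b 0 n.
have hS : square_integrable S by exact: trig_sum_square_integrable.
have fS : circle_int (fun x => f x * S x) =
    pi * \sum_(0 <= k < n) (a k ^+ 2 + b k ^+ 2).
  rewrite circle_intM_trig_sum// mulr_sumr; apply: eq_bigr => k _.
  by rewrite hab !expr2.
have : 0 <= circle_int (fun x => (f x - S x) ^+ 2).
  by apply: Rintegral_ge0 => x _; exact: sqr_ge0.
have -> : (fun x => (f x - S x) ^+ 2) =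
    (fun x => f x ^+ 2 + (S x ^+ 2 + (- 2) * (f x * S x))).
  by apply/funext => x; ring.
have i1 := circle_integrableZ (-2) (square_integrableM hf hS).
rewrite circle_intD; [|exact: hf.2|exact: circle_integrableD hS.2 i1].
rewrite circle_intD//; last exact: hS.2.
rewrite circle_intZ; last exact: square_integrableM.
by rewrite fS circle_int_trig_sum_sq; lra.
Qed.


(** Cut points for which the blocks of a convergent series satisfy the hypothesis
    of [rapid_series_weak_limit]. *)
Lemma rapid_cut_points (c : nat -> R) (C : R) : (forall k, 0 <= c k) ->
  (forall n, \sum_(0 <= k < n) c k <= C) ->
  exists N : nat -> nat, [/\ N 0 = 0%N, (forall j, (N j < N j.+1)%N) &
    forall j n, (0 < j)%N -> \sum_(N j <= k < n) c k <= 4^-1 ^+ j].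
Proof.
move=> c0 cC.
have tail (e : R) : 0 < e -> exists M, forall m n, (M <= m)%N -> \sum_(m <= k < n) c k <= e.
  move=> e0.
  have nd : nondecreasing_seq (fun n => \sum_(0 <= k < n) c k).
    by apply: nondecreasing_series => j *; exact: c0.
  have cv : cvgn (fun n => \sum_(0 <= k < n) c k).
    by apply: nondecreasing_is_cvgn => //; exists C => _ [n _ <-].
  have /cvgrPdist_le/(_ _ e0)[M _ hM] := cv.
  exists M => m n Mm.
  have [mn|/ltnW nm] := leqP m n; last by rewrite big_geq// ltW.
  have := hM _ Mm; rewrite /= ger0_norm ?subr_ge0; last exact: nondecreasing_cvgn_le.
  apply: le_trans; rewrite lerBrDl -big_cat_nat//.
  exact: nondecreasing_cvgn_le.
have [M hM] : {M : nat -> nat & forall j m n, (M j <= m)%N ->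
    \sum_(m <= k < n) c k <= 4^-1 ^+ j}.
  apply: (choice (P := fun j M => forall m n, (M <= m)%N ->
    \sum_(m <= k < n) c k <= 4^-1 ^+ j)) => j.
  by apply: tail; rewrite exprn_gt0// invr_gt0.
pose N := fix N j := if j is i.+1 then (maxn (N i) (M i.+1)).+1 else 0%N.
exists N; split=> // [j|[//|j] n _]; first by rewrite /= ltnS leq_maxl.
by apply: hM; rewrite /= ltnW// ltnS leq_maxr.
Qed.

Lemma sum_trig_sum_blocks a b (N : nat -> nat) n x : N 0 = 0%N ->
  (forall j, (N j < N j.+1)%N) ->
  \sum_(0 <= j < n) trig_sum a b (N j) (N j.+1) x = trig_sum a b 0 (N n) x.
Proof.
move=> N0 Nlt; elim: n => [|n ih]; first by rewrite big_nil N0 /trig_sum big_nil.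
by rewrite big_nat_recr//= ih /trig_sum -big_cat_nat// ltnW.
Qed.

(** The cut points N only depend on the squared amplitudes c, hence serve for a
    series and for its conjugate series at the same time. *)
Lemma riesz_fischer (c : nat -> R) (C : R) : (forall k, 0 <= c k) ->
  (forall n, \sum_(0 <= k < n) c k <= C) ->
  exists N : nat -> nat, forall a b : nat -> R,
    (forall k, a k ^+ 2 + b k ^+ 2 = c k) ->
    exists v, [/\ L2_circle v, has_trig_coefs v a b &
      forall F, square_integrable F ->
        circle_int (fun x => F x * trig_sum a b 0 (N j) x) @[j --> \oo]
          --> circle_int (fun x => F x * v x)].
Proof.
move=> c0 cC; have [N [N0 Nlt Nc]] := rapid_cut_points c0 cC.
have C0 : 0 <= C by have := cC 0%N; rewrite big_nil.
exists N => a b abc.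
pose B j := trig_sum a b (N j) (N j.+1).
have B_circle j : on_circle (B j).
  by move=> x; apply: eq_bigr => k _; exact: trig_mode_periodic.
have B_sq j : square_integrable (B j) by exact: trig_sum_square_integrable.
have B_small j : circle_int (fun x => B j x ^+ 2) <= (pi * (C + 1)) * 4^-1 ^+ j.
  rewrite circle_int_trig_sum_sq -mulrA ler_wpM2l ?pi_ge0//.
  under eq_bigr do rewrite abc.
  case: j => [|j]; first by rewrite N0 expr0 mulr1 (le_trans (cC _))// lerDl.
  apply: le_trans (Nc _ _ (ltn0Sn j)) _.
  by rewrite ler_peMl ?exprn_ge0// ?invr_ge0// lerDr.
have [v vL2 vlim] := rapid_series_weak_limit B_circle B_sq B_small.
have lim F : square_integrable F ->
    circle_int (fun x => F x * trig_sum a b 0 (N j) x) @[j --> \oo]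
      --> circle_int (fun x => F x * v x).
  move=> /vlim; apply: cvg_trans; apply: near_eq_cvg; apply: nearW => n /=.
  by congr circle_int; apply/funext => x; rewrite sum_trig_sum_blocks.
exists v; split=> //; split=> [|k p q].
  have F1 := trig_mode_square_integrable (1 : R) 0 0.
  have -> : circle_int v = circle_int (fun x => trig_mode 1 0 0 x * v x).
    by congr circle_int; apply/funext => x; rewrite trig_mode0 mul1r.
  rewrite -(cvg_lim (@Rhausdorff R) (lim _ F1)).
  apply: lim_near_cst; first exact: Rhausdorff.
  apply: nearW => j; rewrite circle_intM_trig_sum// big1// => k _.
  rewrite (_ : (fun x => _) = trig_mode (a k) (b k) k.+1) ?circle_int_trig_mode//.
  by apply/funext => x; rewrite trig_mode0 mul1r.
have Fk := trig_mode_square_integrable p q k.+1.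
under eq_fun do rewrite mulrC.
rewrite -(cvg_lim (@Rhausdorff R) (lim _ Fk)).
apply: lim_near_cst; first exact: Rhausdorff.
have jN j : (j <= N j)%N.
  by elim: j => // j ih; exact: leq_ltn_trans ih (Nlt j).
exists k.+1 => // j /= kj; rewrite circle_int_trig_mode_sum.
by rewrite (leq_trans kj (jN j)).
Qed.

Lemma has_trig_coefs_unique f g a b : square_integrable f -> square_integrable g ->
  has_trig_coefs f a b -> has_trig_coefs g a b ->
  forall F, square_integrable F ->
    circle_int (fun x => F x * f x) = circle_int (fun x => F x * g x).
Proof.
move=> hf hg [f0 fab] [g0 gab] F hF.
have hd : square_integrable (fun x => f x + -1 * g x).
  by apply: square_integrableD => //; exact: square_integrableZ.
have := trig_coefs_eq0_ae hd.
have fm p q n : circle_int (fun x => (f x + -1 * g x) * trig_mode p q n x) = 0.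
  under eq_fun do rewrite mulrDl -mulrA.
  have tm := trig_mode_square_integrable p q n.
  have i1 := square_integrableM hf tm; have i2 := square_integrableM hg tm.
  rewrite circle_intD ?circle_intZ//; last exact: circle_integrableZ.
  case: n tm i1 i2 => [|n] tm i1 i2; last by rewrite fab gab; ring.
  have E (h : R -> R) : (fun x => h x * trig_mode p q 0 x) = (fun x => p * h x).
    by apply/funext => x; rewrite trig_mode0 mulrC.
  rewrite !E !circle_intZ ?f0 ?g0; first ring.
    exact: square_integrable1.
  exact: square_integrable1.
move=> /(_ fm) d0.
apply: circle_int_ae; first exact: square_integrableM.
  exact: measurable_funM hF.1 hf.1.
apply: (@filterS _ _ (ae_filter_ringOfSetsType mu) _ _ _ d0) => x + xI => /(_ xI).
by rewrite mulN1r => /eqP; rewrite subr_eq0 => /eqP ->.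
Qed.

End RieszFischer.

(** * Conjugate pairs *)

(** This says that p + i q has no Fourier coefficient of frequency n >= 0: the cases
    (a, b) = (1, 0) and (0, 1) are, up to sign, the real and imaginary parts of the
    integral of (p + i q) e^(-inx). *)
Definition conjugate_pair (R : realType) (p q : R -> R) : Prop :=
  [/\ square_integrable p, square_integrable q & forall a b n,
    circle_int (fun x => p x * trig_mode a b n x) +
    circle_int (fun x => q x * trig_mode (- b) a n x) = 0].

Section ConjugatePairs.
Context {R : realType}.
Implicit Types f g h p q : R -> R.
Local Notation mu := (@lebesgue_measure R).

Lemma circle_intM_trig_mode f a b n : square_integrable f ->
  circle_int (fun x => f x * trig_mode a b n x) =
  a * circle_int (fun x => f x * trig_mode 1 0 n x) +
  b * circle_int (fun x => f x * trig_mode 0 1 n x).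
Proof.
move=> hf.
have hi s t : circle_integrable (fun x => f x * trig_mode s t n x).
  by apply: square_integrableM => //; exact: trig_mode_square_integrable.
rewrite -!circle_intZ// -circle_intD; [|exact: circle_integrableZ..].
by congr circle_int; apply/funext => x; rewrite /trig_mode; ring.
Qed.

(** The case n = 0 of the definition makes both mean values vanish. *)
Lemma conjugate_pair_coefs p q : conjugate_pair p q ->
  exists a b : nat -> R, has_trig_coefs p a b /\ has_trig_coefs q b (fun k => - a k).
Proof.
move=> [hp hq pq].
have pi0 : pi != 0 :> R by rewrite gt_eqF// pi_gt0.
have E s t f : (fun x => f x * trig_mode s t 0 x) = (fun x => s * f x).
  by apply/funext => x; rewrite trig_mode0 mulrC.
have p0 : circle_int p = 0.
  have := pq 1 0 0%N; rewrite !E !circle_intZ; [|exact: square_integrable1..].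
  by rewrite mul1r oppr0 mul0r addr0.
have q0 : circle_int q = 0.
  have := pq 0 (-1) 0%N; rewrite !E !circle_intZ; [|exact: square_integrable1..].
  by rewrite opprK mul1r mul0r add0r.
exists (fun k => pi^-1 * circle_int (fun x => p x * trig_mode 1 0 k.+1 x)).
exists (fun k => pi^-1 * circle_int (fun x => p x * trig_mode 0 1 k.+1 x)).
split; split=> // k c d; rewrite circle_intM_trig_mode//.
  by move: pi pi0 => P P0; field.
have := pq 1 0 k.+1; have := pq 0 1 k.+1.
rewrite oppr0 (circle_intM_trig_mode (-1))// => h1 h2.
have -> : circle_int (fun x => q x * trig_mode 1 0 k.+1 x) =
   circle_int (fun x => p x * trig_mode 0 1 k.+1 x) by lra.
have -> : circle_int (fun x => q x * trig_mode 0 1 k.+1 x) =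
   - circle_int (fun x => p x * trig_mode 1 0 k.+1 x) by lra.
by move: pi pi0 => P P0; field.
Qed.

(** Multiplying by X shifts a mode of frequency k + 1 by at most 1, so only
    frequencies k, k + 1 and k + 2, all nonnegative, are tested on the pair. *)
Lemma conjugate_pair_mode f f2 a b c0 c d k : conjugate_pair f f2 ->
  circle_int (fun x => f x * (c0 + trig_mode c d 1 x) * trig_mode b (- a) k.+1 x) +
  circle_int (fun x => f2 x * (c0 + trig_mode c d 1 x) * trig_mode a b k.+1 x) = 0.
Proof.
move=> [hf hf2 ff2].
have expand h s t : square_integrable h ->
    circle_int (fun x => h x * (c0 + trig_mode c d 1 x) * trig_mode s t k.+1 x) =
    circle_int (fun x => h x * trig_mode (c0 * s) (c0 * t) k.+1 x) +
    (circle_int (fun x => h x *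
      trig_mode ((s * c - t * d) / 2) ((s * d + t * c) / 2) k.+2 x) +
     circle_int (fun x => h x *
      trig_mode ((s * c + t * d) / 2) ((t * c - s * d) / 2) k x)).
  move=> hh.
  have hi u v n : circle_integrable (fun x => h x * trig_mode u v n x).
    by apply: square_integrableM => //; exact: trig_mode_square_integrable.
  rewrite -circle_intD// -circle_intD//; last exact: circle_integrableD.
  congr circle_int; apply/funext => x.
  rewrite -mulrA mulrDl -trig_modeZ [trig_mode c d _ _ * _]mulrC trig_modeM//.
  by rewrite addn1 subn1 !mulrDr.
rewrite !expand//.
have h1 := ff2 (c0 * b) (c0 * - a) k.+1.
have h2 := ff2 ((b * c - - a * d) / 2) ((b * d + - a * c) / 2) k.+2.
have h3 := ff2 ((b * c + - a * d) / 2) ((- a * c - b * d) / 2) k.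
have e1 : - (c0 * - a) = c0 * a by ring.
have e2 : - ((b * d + - a * c) / 2) = (a * c - b * d) / 2 by ring.
have e2' : (b * c - - a * d) / 2 = (a * d + b * c) / 2 by ring.
have e3 : - ((- a * c - b * d) / 2) = (a * c + b * d) / 2 by ring.
have e3' : (b * c + - a * d) / 2 = (b * c - a * d) / 2 by ring.
rewrite e1 in h1; rewrite e2 e2' in h2; rewrite e3 e3' in h3.
rewrite e2' e3'.
lra.
Qed.

(** This is the imaginary part of the integral of (f + i f2) (g2 + i g) X. *)
Lemma conjugate_pair_orthogonal f f2 g2 g c0 c d :
  conjugate_pair f f2 -> conjugate_pair g2 g ->
  circle_int (fun x => f x * (c0 + trig_mode c d 1 x) * g x) +
  circle_int (fun x => f2 x * (c0 + trig_mode c d 1 x) * g2 x) = 0.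
Proof.
move=> ff2 /[dup] -[hg2 hg _] /conjugate_pair_coefs[a [b [g2ab gab]]].
have [hf hf2 _] := ff2.
pose X x := c0 + trig_mode c d 1 x.
have cX : continuous X.
  by move=> x; apply: cvgD; [exact: cvg_cst|exact: trig_mode_continuous].
have fX := square_integrableM_continuous hf cX.
have f2X := square_integrableM_continuous hf2 cX.
have [||N hN] := @riesz_fischer R (fun k => a k ^+ 2 + b k ^+ 2)
  (pi^-1 * circle_int (fun x => g2 x ^+ 2)).
- by move=> k; rewrite addr_ge0// sqr_ge0.
- by move=> n; exact: bessel.
have [|v [/L2_circle_square_integrable hv vab vlim]] := hN b (fun k => - a k).
  by move=> k; rewrite sqrrN addrC.
have [//|v2 [/L2_circle_square_integrable hv2 v2ab v2lim]] := hN a b.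
rewrite (has_trig_coefs_unique hg hv gab vab fX).
rewrite (has_trig_coefs_unique hg2 hv2 g2ab v2ab f2X).
rewrite -(cvg_lim (@Rhausdorff R) (cvgD (vlim _ fX) (v2lim _ f2X))).
apply: lim_near_cst; first exact: Rhausdorff.
apply: nearW => j; rewrite [LHS](_ : _ =
  circle_int (fun x => f x * X x * trig_sum b (fun k => - a k) 0 (N j) x) +
  circle_int (fun x => f2 x * X x * trig_sum a b 0 (N j) x))//.
rewrite !circle_intM_trig_sum// -big_split/= big1// => k _.
exact: conjugate_pair_mode.
Qed.

End ConjugatePairs.

(** * Sobolev functions on the circle *)

Section SobolevCircle.
Context {R : realType}.
Implicit Types f g h u v phi psi : R -> R.
Local Notation mu := (@lebesgue_measure R).

Lemma smooth_derive1 phi : smooth_circle phi -> smooth_circle (derive1 phi).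
Proof.
move=> [pphi dphi]; split.
  move=> x; rewrite /derive1 pphi.
  have -> // : (fun t => t^-1 *: (phi (t + (x + pi *+ 2)) - phi x)) =
    (fun t => t^-1 *: (phi (t + x) - phi x)).
  by apply/funext => t; rewrite addrA pphi.
by move=> n x; have := dphi n.+1 x; rewrite derive1Sn.
Qed.

Lemma smooth_derivable phi x : smooth_circle phi -> derivable phi x 1.
Proof. by move=> [_ /(_ 0%N x)]. Qed.

Lemma smooth_continuous phi : smooth_circle phi -> continuous phi.
Proof.
by move=> h x; apply/differentiable_continuous/derivable1_diffP; exact: smooth_derivable.
Qed.

(** Unlike products alone, this class is stable under differentiation, so that
    smoothness of products follows from first-order derivability. *)
Inductive sum_of_smooth_products : (R -> R) -> Prop :=
| smooth_product f g : smooth_circle f -> smooth_circle g ->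
    sum_of_smooth_products (f \* g)
| smooth_productD f g : sum_of_smooth_products f -> sum_of_smooth_products g ->
    sum_of_smooth_products (f \+ g).

Lemma sum_of_smooth_products_derivable h x : sum_of_smooth_products h -> derivable h x 1.
Proof.
elim=> {h} [f g sf sg|f g _ hf _ hg]; last exact: derivableD.
by apply: derivableM; exact: smooth_derivable.
Qed.

Lemma sum_of_smooth_products_derive1 h :
  sum_of_smooth_products h -> sum_of_smooth_products (derive1 h).
Proof.
elim=> {h} [f g sf sg|f g sf hf sg hg].
  have -> : derive1 (f \* g) = (derive1 f \* g) \+ (f \* derive1 g).
    apply/funext => x; rewrite !derive1E deriveM; try exact: smooth_derivable.
    by rewrite /= !derive1E /GRing.scale/= addrC; congr (_ + _); rewrite mulrC.
  by apply: smooth_productD; apply: smooth_product => //; exact: smooth_derive1.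
have -> : derive1 (f \+ g) = derive1 f \+ derive1 g; last exact: smooth_productD.
by apply/funext => x; rewrite /= !derive1E deriveD//; exact: sum_of_smooth_products_derivable.
Qed.

Lemma smoothM phi psi : smooth_circle phi -> smooth_circle psi ->
  smooth_circle (fun x => phi x * psi x).
Proof.
move=> sphi spsi; split.
  by move=> x; rewrite sphi.1 spsi.1.
move=> n x; apply: sum_of_smooth_products_derivable.
elim: n => [|n ih]; first exact: smooth_product.
by rewrite derive1nS; exact: sum_of_smooth_products_derive1.
Qed.

Lemma derive1_trig_mode (a b : R) n :
  derive1 (trig_mode a b n) = trig_mode (n%:R * b) (- (n%:R * a)) n.
Proof.
apply/funext => x; rewrite derive1E.
by have dx := is_derive_trig_mode a b n x; rewrite derive_val.
Qed.

Lemma trig_mode_smooth (a b : R) n : smooth_circle (trig_mode a b n).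
Proof.
split; first exact: trig_mode_periodic.
move=> m x; have [p [q ->]] : exists p q, derive1n m (trig_mode a b n) = trig_mode p q n.
  elim: m => [|m [p [q ih]]]; first by exists a, b.
  by rewrite derive1nS ih derive1_trig_mode; do 2 eexists.
by have dx := is_derive_trig_mode p q n x; exact: ex_derive.
Qed.

Lemma weak_derivativeP u : H1_circle u ->
  L2_circle (weak_derivative u) /\ is_weak_derivative u (weak_derivative u).
Proof.
move=> [_ ex].
exact: (@xgetPex _ (cst 0) [set v | L2_circle v /\ is_weak_derivative u v] ex).
Qed.

Lemma weak_derivative_trig_mode u v a b n : is_weak_derivative u v ->
  circle_int (fun x => v x * trig_mode a b n x) =
  - circle_int (fun x => u x * trig_mode (n%:R * b) (- (n%:R * a)) n x).
Proof.
by move=> /(_ _ (trig_mode_smooth a b n)); rewrite derive1_trig_mode => ->; rewrite opprK.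
Qed.

(** Leibniz: test the weak derivative of u on phi psi. *)
Lemma H1M_smooth u phi : H1_circle u -> smooth_circle phi -> H1_circle (u \* phi).
Proof.
move=> hu sphi; have [L2u' wu'] := weak_derivativeP hu.
have [[pu mu_ _] _] := hu; have [pu' mu' _] := L2u'.
have su := L2_circle_square_integrable hu.1.
have su' := L2_circle_square_integrable L2u'.
have sd := smooth_derive1 sphi.
have cphi := smooth_continuous sphi; have cd := smooth_continuous sd.
have L2M f psi : L2_circle f -> smooth_circle psi -> L2_circle (f \* psi).
  move=> Lf spsi; have [mf i2] := square_integrableM_continuous
    (L2_circle_square_integrable Lf) (smooth_continuous spsi).
  by split=> // x; case: Lf => /= pf _ _; rewrite pf spsi.1.
have [s1 s2] := (L2M _ _ L2u' sphi, L2M _ _ hu.1 sd).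
split; first exact: L2M hu.1 sphi.
exists (fun x => weak_derivative u x * phi x + u x * derive1 phi x); split.
  have [mf i2] := square_integrableD (L2_circle_square_integrable s1) (L2_circle_square_integrable s2).
  have [[p1 _ _] [p2 _ _]] := (s1, s2).
  split=> // x.
  exact: f_equal2 (p1 x) (p2 x).
move=> psi spsi.
have cpsi := smooth_continuous spsi.
have sq_psi := continuous_square_integrable cpsi.
have i1 := square_integrableM (L2_circle_square_integrable s1) sq_psi.
have i2 := square_integrableM (L2_circle_square_integrable s2) sq_psi.
have i3 : circle_integrable (fun x => u x * phi x * derive1 psi x).
  apply: square_integrableM (L2_circle_square_integrable (L2M _ _ hu.1 sphi)) _.
  exact/continuous_square_integrable/smooth_continuous/smooth_derive1.
have := wu' _ (smoothM sphi spsi).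
have -> : (fun x => u x * derive1 (fun x => phi x * psi x) x) =
    (fun x => u x * phi x * derive1 psi x + u x * derive1 phi x * psi x).
  apply/funext => x; rewrite !derive1E deriveM; try exact: smooth_derivable.
  by rewrite /GRing.scale/=; ring.
rewrite circle_intD// => E.
under [in RHS]eq_fun do rewrite mulrDl.
rewrite circle_intD// opprD.
rewrite (_ : (fun x => weak_derivative u x * phi x * psi x) =
  (fun x => weak_derivative u x * (phi x * psi x))); last first.
  by apply/funext => x; rewrite mulrA.
by rewrite -E addrK.
Qed.

(** The complex Fourier coefficients over all integers carry the same information
    as the real modes of nonnegative frequency. *)
Lemma is_half_laplacianP u v : square_integrable u -> square_integrable v ->
  is_half_laplacian u v <->
  forall a b n, circle_int (fun x => v x * trig_mode a b n x) =
    n%:R * circle_int (fun x => u x * trig_mode a b n x).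
Proof.
move=> hu hv.
have pi2 : pi *+ 2 != 0 :> R by rewrite gt_eqF// twopi_gt0.
have coefE f (m : nat) (e : bool) : square_integrable f ->
    fourier_coef f ((-1) ^+ e * m%:Z) =
    Complex (circle_int (fun x => f x * trig_mode 1 0 m x) / (pi *+ 2))
      (- (circle_int (fun x => f x * trig_mode 0 ((-1) ^+ e) m x) / (pi *+ 2))).
  move=> hf; rewrite /fourier_coef.
  have E x : ((-1) ^+ e * m%:Z)%:~R * x = (-1) ^+ e * (m%:R * x) :> R.
    by rewrite intrM rmorphXn/= mulrA.
  by congr (Complex (circle_int _ / _) (- (circle_int _ / _))); apply/funext => x;
    rewrite /trig_mode E; case: e {E}; rewrite ?expr1 ?expr0 ?mulN1r ?mul1r ?cosN ?sinN; ring.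
have natC (m : nat) (p q : R) : (m%:R : R[i]) * (Complex p q) = Complex (m%:R * p) (m%:R * q).
  by rewrite -(rmorph_nat (real_complex R)) /=; simpc.
split=> [h a b n|h k].
  have := h n%:Z; rewrite -[n%:Z]mul1r -[1]/((-1) ^+ false).
  rewrite !coefE// expr0 mul1r ger0_norm//= -pmulrn natC => -[].
  rewrite mulrA => /(mulIf (invr_neq0 pi2)) h1.
  rewrite mulrN mulrA => /oppr_inj /(mulIf (invr_neq0 pi2)) h2.
  by rewrite circle_intM_trig_mode// h1 h2 [in RHS]circle_intM_trig_mode//; ring.
rewrite [k]intEsign !coefE// normrM normrX normrN1 expr1n mul1r ger0_norm// -pmulrn natC.
by rewrite !h !mulrA mulrN mulrA.
Qed.

(** The Fourier coefficients required of the half Laplacian have the same squared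
    amplitudes as those of u', which are summable by Bessel's inequality. *)
Lemma half_laplacian_exists u : H1_circle u ->
  exists v, L2_circle v /\ is_half_laplacian u v.
Proof.
move=> hu; have [L2u' wu'] := weak_derivativeP hu.
have su := L2_circle_square_integrable hu.1.
have su' := L2_circle_square_integrable L2u'.
have pi0 : pi != 0 :> R by rewrite gt_eqF// pi_gt0.
pose A k := pi^-1 * circle_int (fun x => u x * trig_mode 1 0 k.+1 x).
pose B k := pi^-1 * circle_int (fun x => u x * trig_mode 0 1 k.+1 x).
have uAB k c d : circle_int (fun x => u x * trig_mode c d k.+1 x) =
    pi * (A k * c + B k * d).
  rewrite circle_intM_trig_mode// /A /B.
  by move: pi pi0 => P P0; field.
have u'AB : has_trig_coefs (weak_derivative u)
    (fun k => k.+1%:R * B k) (fun k => - (k.+1%:R * A k)).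
  split=> [|k c d].
    have := weak_derivative_trig_mode 1 0 0 wu'.
    rewrite (_ : (fun x => weak_derivative u x * _) = weak_derivative u).
      move=> ->; rewrite (_ : (fun x => _) = fun=> 0) ?circle_int0 ?oppr0//.
      by apply/funext => x; rewrite trig_mode0 !mul0r mulr0.
    by apply/funext => x; rewrite trig_mode0 mulr1.
  by rewrite (weak_derivative_trig_mode _ _ _ wu') uAB; ring.
have [||N hN] := @riesz_fischer R (fun k => (k.+1%:R * A k) ^+ 2 + (k.+1%:R * B k) ^+ 2)
  (pi^-1 * circle_int (fun x => weak_derivative u x ^+ 2)).
- by move=> k; rewrite addr_ge0// sqr_ge0.
- move=> n; apply: le_trans (bessel n su' u'AB).
  by apply: ler_sum => k _; rewrite sqrrN addrC.
have [//|v [L2v [v0 vAB] _]] := hN (fun k => k.+1%:R * A k) (fun k => k.+1%:R * B k).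
exists v; split=> //.
apply/is_half_laplacianP => //; first exact: L2_circle_square_integrable.
move=> a b [|n]; last by rewrite vAB uAB; ring.
rewrite mul0r (_ : (fun x => _) = (fun x => a * v x)).
  rewrite circle_intZ ?v0 ?mulr0//.
  exact/square_integrable1/L2_circle_square_integrable.
by apply/funext => x; rewrite trig_mode0 mulrC.
Qed.

Lemma half_laplacianP u : H1_circle u ->
  L2_circle (half_laplacian u) /\ is_half_laplacian u (half_laplacian u).
Proof.
move=> /half_laplacian_exists ex.
exact: (@xgetPex _ (cst 0) [set v | L2_circle v /\ is_half_laplacian u v] ex).
Qed.

(** At frequency n the coefficients of L u and u' are |n| and i n times that
    of u, and |n| - n = 0 for n >= 0. *)
Lemma conjugate_pair_H1 u : H1_circle u ->
  conjugate_pair (half_laplacian u) (weak_derivative u).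
Proof.
move=> hu; have [L2u' wu'] := weak_derivativeP hu.
have [L2l hl] := half_laplacianP hu.
have su := L2_circle_square_integrable hu.1.
have sl := L2_circle_square_integrable L2l.
split=> //; first exact: L2_circle_square_integrable.
move=> a b n; rewrite (is_half_laplacianP su sl).1//.
rewrite (weak_derivative_trig_mode _ _ _ wu') -circle_intZ.
  apply/eqP; rewrite subr_eq0; apply/eqP; congr circle_int; apply/funext => x.
  by rewrite /trig_mode; ring.
by apply: square_integrableM => //; exact: trig_mode_square_integrable.
Qed.

Lemma commutator_identity u w c0 c d : H1_circle u -> H1_circle w ->
  - circle_int (fun x => half_laplacian u x * (c0 + trig_mode c d 1 x) * weak_derivative w x)
  = circle_int (fun x => weak_derivative u x * (c0 + trig_mode c d 1 x) * half_laplacian w x).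
Proof.
move=> hu hw; apply/eqP; rewrite eq_sym -addr_eq0 addrC; apply/eqP.
by apply: conjugate_pair_orthogonal; exact: conjugate_pair_H1.
Qed.

(** The case w = u of [commutator_identity], where both sides are opposite. *)
Lemma energy_identity u c0 c d : H1_circle u ->
  circle_int (fun x => weak_derivative u x * half_laplacian u x * (c0 + trig_mode c d 1 x)) = 0.
Proof.
move=> hu; have hp := conjugate_pair_H1 hu.
have := conjugate_pair_orthogonal c0 c d hp hp.
set E := circle_int (fun x => weak_derivative u x * half_laplacian u x * _).
have -> : circle_int (fun x => half_laplacian u x * (c0 + trig_mode c d 1 x) * weak_derivative u x) = E.
  by congr circle_int; apply/funext => x; ring.
have -> : circle_int (fun x => weak_derivative u x * (c0 + trig_mode c d 1 x) * half_laplacian u x) = E.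
  by congr circle_int; apply/funext => x; ring.
lra.
Qed.

End SobolevCircle.

(** * Flows of disc automorphisms *)

Section MobiusFlows.
Context {R : realType}.
Implicit Types (X : R -> R) (Phi : R -> R -> R).

Lemma expiD (x y : R) : expi (x + y) = expi x * expi y.
Proof. by rewrite /expi cosD sinD; simpc; rewrite [sin x * _ + _]addrC. Qed.

Lemma expi_unit (x : R) : expi x * expi (- x) = 1.
Proof. by rewrite -expiD subrr /expi cos0 sin0. Qed.

(** With P = e^(i (g x + x) / 2) and Q = e^(i (g x - x) / 2), the equation of the
    automorphism with parameters m and a becomes K + m (conj K) = 0 where
    K = (conj a) P - Q.  Its real and imaginary parts are two real linear relations
    of the announced form, one of which is not trivial in r, s. *)
Lemma automorphism_trace_half_angles (g : R -> R) : is_automorphism_trace g ->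
  exists p q r s : R, (r != 0 \/ s != 0) /\ forall x,
    p * cos ((g x + x) / 2) + q * sin ((g x + x) / 2) +
    r * cos ((g x - x) / 2) + s * sin ((g x - x) / 2) = 0.
Proof.
move=> [m [a [_ _ hg]]].
have key x : (conjc a * expi ((g x + x) / 2) - expi ((g x - x) / 2)) +
    m * (a * expi (- ((g x + x) / 2)) - expi (- ((g x - x) / 2))) = 0.
  set h := (g x + x) / 2; set k := (g x - x) / 2.
  have gx : g x = h + k by rewrite /h /k; field.
  have xE : x = h + - k by rewrite /h /k; field.
  have := hg x; rewrite gx [in RHS]xE !expiD /disc_automorphism.
  have hP := expi_unit h; have hQ := expi_unit k.
  move: (expi h) (expi (- h)) (expi k) (expi (- k)) hP hQ => P P' Q Q' hP hQ.
  set den := conjc a * (P * Q') - 1 => E.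
  (* division by zero returns 0, which is not a point of the circle *)
  have den0 : den != 0.
    apply/negP => /eqP d0; move: E; rewrite d0 invr0 !mulr0 => PQ0.
    have : (P * P') * (Q * Q') = 0 by rewrite mulrACA PQ0 mul0r.
    by rewrite hP hQ mulr1 => /eqP; rewrite oner_eq0.
  have {}E : P * Q * den - m * (P * Q' - a) = 0.
    by rewrite E mulrA mulfVK// subrr.
  have -> : conjc a * P - Q + m * (a * P' - Q') =
     P' * (P * Q * den - m * (P * Q' - a)) +
     (1 - P * P') * (Q * den - m * Q') + (1 - Q * Q') * (conjc a * P).
    by rewrite /den; ring.
  by rewrite E hP hQ subrr !mul0r mulr0 !addr0.
case: m key {hg} => m1 m2; case: a => a1 a2 key.
have {}key x :
    (1 + m1) * (a1 * cos ((g x + x) / 2) + a2 * sin ((g x + x) / 2) - cos ((g x - x) / 2)) +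
    m2 * (a1 * sin ((g x + x) / 2) - a2 * cos ((g x + x) / 2) - sin ((g x - x) / 2)) = 0 /\
    m2 * (a1 * cos ((g x + x) / 2) + a2 * sin ((g x + x) / 2) - cos ((g x - x) / 2)) +
    (1 - m1) * (a1 * sin ((g x + x) / 2) - a2 * cos ((g x + x) / 2) - sin ((g x - x) / 2)) = 0.
  have := key x; rewrite /expi !cosN !sinN.
  move/eqP; rewrite eq_complex => /andP[/eqP/= e1 /eqP/= e2].
  by split; [rewrite -[RHS]e1|rewrite -[RHS]e2]; ring.
(* if 1 + m1 = 0 then 1 - m1 = 2, so one of the two relations is nontrivial *)
have [m1N|m1N] := eqVneq (1 + m1) 0.
  exists (m2 * a1 - (1 - m1) * a2), (m2 * a2 + (1 - m1) * a1), (- m2), (- (1 - m1)); split.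
    by right; rewrite oppr_eq0; apply/eqP; lra.
  by move=> x; rewrite -[RHS](key x).2; ring.
exists ((1 + m1) * a1 - m2 * a2), ((1 + m1) * a2 + m2 * a1), (- (1 + m1)), (- m2); split.
  by left; rewrite oppr_eq0.
by move=> x; rewrite -[RHS](key x).1; ring.
Qed.

Definition det3 (a b c : nat -> R) (i j k : nat) : R :=
  a i * (b j * c k - b k * c j) - a j * (b i * c k - b k * c i)
  + a k * (b i * c j - b j * c i).

(** Up to sign, the 4 x 4 determinant with rows (a i, b i, c i, d i), expanded along
    the last column, which is the one that vanishes at time 0 of a flow. *)
Definition det4 (a b c d : nat -> R) : R :=
  d 0%N * det3 a b c 1 2 3 - d 1%N * det3 a b c 0 2 3
  + d 2%N * det3 a b c 0 1 3 - d 3%N * det3 a b c 0 1 2.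

(** Cramer's rule, along the third or the fourth column. *)
Lemma det4_eq0 (a b c d : nat -> R) p q r s : r != 0 \/ s != 0 ->
  (forall j, p * a j + q * b j + r * c j + s * d j = 0) -> det4 a b c d = 0.
Proof.
move=> rs h.
have sD : s * det4 a b c d = 0.
  transitivity ((p * a 0%N + q * b 0%N + r * c 0%N + s * d 0%N) * det3 a b c 1 2 3
    - (p * a 1%N + q * b 1%N + r * c 1%N + s * d 1%N) * det3 a b c 0 2 3
    + (p * a 2%N + q * b 2%N + r * c 2%N + s * d 2%N) * det3 a b c 0 1 3
    - (p * a 3%N + q * b 3%N + r * c 3%N + s * d 3%N) * det3 a b c 0 1 2).
    by rewrite /det4 /det3; ring.
  by rewrite !h !mul0r subrr addr0 subrr.
have rD : r * det4 a b c d = 0.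
  transitivity (- ((p * a 0%N + q * b 0%N + r * c 0%N + s * d 0%N) * det3 a b d 1 2 3
    - (p * a 1%N + q * b 1%N + r * c 1%N + s * d 1%N) * det3 a b d 0 2 3
    + (p * a 2%N + q * b 2%N + r * c 2%N + s * d 2%N) * det3 a b d 0 1 3
    - (p * a 3%N + q * b 3%N + r * c 3%N + s * d 3%N) * det3 a b d 0 1 2)).
    by rewrite /det4 /det3; ring.
  by rewrite !h !mul0r subrr addr0 subrr oppr0.
case: rs => [r0|s0].
  by move/eqP: rD; rewrite mulf_eq0 (negbTE r0) => /eqP.
by move/eqP: sD; rewrite mulf_eq0 (negbTE s0) => /eqP.
Qed.

Lemma cvg_det3 (T : Type) (F : set_system T) (FF : Filter F)
    (a b c : nat -> T -> R) (a0 b0 c0 : nat -> R) i j k :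
  (forall n, a n @ F --> a0 n) -> (forall n, b n @ F --> b0 n) ->
  (forall n, c n @ F --> c0 n) ->
  det3 (a ^~ t) (b ^~ t) (c ^~ t) i j k @[t --> F] --> det3 a0 b0 c0 i j k.
Proof.
move=> ha hb hc; rewrite /det3.
by apply: cvgD; [apply: cvgB|]; (apply: cvgM; [exact: ha|]);
  apply: cvgB; (apply: cvgM; [exact: hb|exact: hc]).
Qed.

(** Apply [det4_eq0] to the relation of [automorphism_trace_half_angles] at the
    points 0, pi / 2, pi and x.  At time 0 the columns are cos, sin, 1 and 0, and the
    last one has derivative X / 2: dividing the determinant by the time t and
    letting t tend to 0 gives a linear relation between cos, sin, 1 and X. *)
Lemma flows_by_automorphisms_trig X : flows_by_automorphisms X ->
  exists c0 c d, forall x, X x = c0 + trig_mode c d 1 x.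
Proof.
move=> [Phi [[Phi0 _ dPhi] aPhi]].
have dPhi0 y : is_derive (0 : R) (1 : R) (fun s => Phi s y) (X y).
  by have := dPhi 0 y; rewrite Phi0.
have cPhi y : Phi t y @[t --> 0^'] --> y.
  rewrite -[X in _ --> X](Phi0 y); apply: cvg_within_filter.
  apply: (@differentiable_continuous _ _ _ 0 (fun s => Phi s y)).
  by apply/derivable1_diffP; exact: ex_derive.
pose A y t := cos ((Phi t y + y) / 2); pose B y t := sin ((Phi t y + y) / 2).
pose C y t := cos ((Phi t y - y) / 2); pose D y t := sin ((Phi t y - y) / 2).
have cA y : A y @ 0^' --> cos y.
  rewrite [X in _ --> cos X](_ : _ = (y + y) / 2); last by field.
  apply: (@cvg_comp _ _ _ (fun t => (Phi t y + y) / 2) cos); last exact: continuous_cos.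
  by apply: cvgM; [apply: cvgD => //; exact: cvg_cst|exact: cvg_cst].
have cB y : B y @ 0^' --> sin y.
  rewrite [X in _ --> sin X](_ : _ = (y + y) / 2); last by field.
  apply: (@cvg_comp _ _ _ (fun t => (Phi t y + y) / 2) sin); last exact: continuous_sin.
  by apply: cvgM; [apply: cvgD => //; exact: cvg_cst|exact: cvg_cst].
have cC y : C y @ 0^' --> (1 : R).
  rewrite -(@cos0 R) [X in _ --> cos X](_ : _ = (y - y) / 2); last by rewrite subrr mul0r.
  apply: (@cvg_comp _ _ _ (fun t => (Phi t y - y) / 2) cos); last exact: continuous_cos.
  by apply: cvgM; [apply: cvgB => //; exact: cvg_cst|exact: cvg_cst].
have cD y : t^-1 * D y t @[t --> 0^'] --> X y / 2.
  have dD : is_derive (0 : R) (1 : R) (D y) (X y / 2).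
    have dh : is_derive (0 : R) (1 : R) (fun t => 2^-1 *: (Phi t y - y)) (2^-1 *: (X y - 0)).
      exact: is_deriveZ.
    have ds : is_derive (2^-1 *: (Phi 0 y - y)) (1 : R) sin 1.
      by rewrite Phi0 subrr scaler0 -[X in is_derive _ _ _ X](@cos0 R); exact: is_derive_sin.
    have -> : D y = sin \o (fun t => 2^-1 *: (Phi t y - y)).
      by apply/funext => t; rewrite /D /= mulrC.
    have dc := @is_derive1_comp R sin (fun t => 2^-1 *: (Phi t y - y)) 0 _ _ ds dh.
    apply: (is_derive_eq dc).
    by rewrite subr0 /GRing.scale/= mul1r mulrC.
  have := @ex_derive _ _ _ _ _ _ _ dD; rewrite /derivable => cv.
  have : t^-1 *: (D y (t *: 1 + 0) - D y 0) @[t --> 0^'] --> 'D_1 (D y) 0 by exact: cv.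
  rewrite derive_val; apply: cvg_trans; apply: near_eq_cvg; apply: nearW => t.
  rewrite {2}/D Phi0 subrr mul0r sin0 subr0 addr0.
  by rewrite /GRing.scale/= mulr1.
pose xs (x : R) (n : nat) : R := nth x [:: 0; pi / 2; pi] n.
have zero x : det4 (fun n => cos (xs x n)) (fun n => sin (xs x n)) (fun=> 1)
    (fun n => X (xs x n) / 2) = 0.
  have lim : det4 (fun n => A (xs x n) t) (fun n => B (xs x n) t)
      (fun n => C (xs x n) t) (fun n => t^-1 * D (xs x n) t) @[t --> 0^'] -->
      det4 (fun n => cos (xs x n)) (fun n => sin (xs x n)) (fun=> 1)
        (fun n => X (xs x n) / 2).
    have c3 i j k := @cvg_det3 _ (0 : R)^' _ (fun n => A (xs x n)) (fun n => B (xs x n))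
      (fun n => C (xs x n)) _ _ _ i j k (fun n => cA _) (fun n => cB _) (fun n => cC _).
    rewrite /det4.
    apply: cvgB; [apply: cvgD; [apply: cvgB|]|];
      by apply: cvgM; [exact: cD|exact: c3].
  rewrite -(cvg_lim (@Rhausdorff R) lim); apply: lim_near_cst; first exact: Rhausdorff.
  apply: nearW => t; have [p [q [r [s [rs pqrs]]]]] := automorphism_trace_half_angles (aPhi t).
  have := det4_eq0 rs (fun n => pqrs (xs x n)).
  rewrite /det4 => E; apply/eqP; rewrite -!(mulrA t^-1) -!mulrBr -!mulrDr -!mulrBr.
  by rewrite mulf_eq0 E eqxx orbT.
exists ((X 0 + X pi) / 2), ((X 0 - X pi) / 2), (X (pi / 2) - (X 0 + X pi) / 2) => x.
have := zero x; rewrite /det4 /det3 /xs /= /trig_mode mul1r.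
rewrite cos0 sin0 cos_pihalf sin_pihalf cospi sinpi => E.
lra.
Qed.

End MobiusFlows.

(** * The identities *)

Theorem proposition1p5 (R : realType) (u : R -> R) (hu : H1_circle u) :
  [/\ forall X : R -> R, on_circle X -> flows_by_automorphisms X ->
        forall phi : R -> R, smooth_circle phi ->
          product_derivative u X phi = product_half_laplacian u X phi,
      circle_int (fun x => weak_derivative u x * half_laplacian u x) = 0 &
      forall delta : R,
        circle_int (fun x =>
          weak_derivative u x * half_laplacian u x * sin (x - delta)) = 0].
Proof.
split=> [X _ /flows_by_automorphisms_trig[c0 [c [d XE]]] phi sphi||delta].
- have -> : X = (fun x => c0 + trig_mode c d 1 x) by exact/funext.
  exact: commutator_identity (H1M_smooth hu sphi).
- rewrite -[RHS](energy_identity 1 0 0 hu); congr circle_int; apply/funext => x.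
  by rewrite /trig_mode !mul0r !addr0 mulr1.
- rewrite -[RHS](energy_identity 0 (- sin delta) (cos delta) hu).
  congr circle_int; apply/funext => x.
  by rewrite /trig_mode mul1r sinB; congr (_ * _); ring.
Qed.
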